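(* Let $k$ be a field and let $A$ be an Artinian $k$-algebra. Then $A$ is splitting over its radical if and only if $A$ is of Gabriel-type for generalized path algebras, i.e., there is a surjective $k$-algebra homomorphism $\pi:k(\Delta_A,\mathcal A)\rightarrow A$ such that $\ker(\pi)\subseteq J$, where $k(\Delta_A,\mathcal A)$ is the associated generalized path algebra of $A$ and $J$ is its ideal generated by all virtual $\mathcal A$-paths of length $1$.
   Context: Artinian means left Artinian. Let $r$ be the Jacobson radical of $A$. $A$ is splitting over its radical if there is a $k$-algebra homomorphism $\rho:A/r\to A$ with $p\circ\rho=\mathrm{Id}_{A/r}$, where $p:A\to A/r$ is the quotient map. Write $A/r=\bigoplus_{i\in\Delta_0}A_i$ with $A_i$ two-sided simple ideals (simple algebras). Natural quiver $\Delta_A$: vertex set $\Delta_0$; the number $t_{ij}$ of arrows from $i$ to $j$ is the minimal number of generators of $A_j\cdot(r/r^2)\cdot A_i$ as an $A_j$-$A_i$-bimodule ($0$ if this bimodule is zero). Associated generalized path algebra: let $\mathcal A=\{A_i : i\in\Delta_0\}$, $A_0=\prod_{i}A_i$, let $\Omega(i,j)$ be the set of arrows from $i$ to $j$ in $\Delta_A$, let $A_j\Omega(i,j)A_i$ be the free $A_j$-$A_i$-bimodule (free $A_j\otimes_kA_i^{op}$-module) with basis $\Omega(i,j)$, and $M=\bigoplus_{i,j}A_j\Omega(i,j)A_i$, an $A_0$-$A_0$-bimodule. Then $k(\Delta_A,\mathcal A)=T_{A_0}(M)=\bigoplus_{n\ge0}M^{\otimes_{A_0}n}$ is the tensor algebra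 (with $M^{\otimes_{A_0}0}=A_0$), elements of $M^{\otimes_{A_0}n}$ are the virtual $\mathcal A$-paths of length $n$, and $J=\bigoplus_{n\ge1}M^{\otimes_{A_0}n}$. *)

(* Defs.v *)
From HB Require Import structures.
From mathcomp Require Import all_boot all_algebra.
From mathcomp Require Import boolp classical_sets.
From mathcomp Require Import freeg.

Set Implicit Arguments.
Unset Strict Implicit.
Unset Printing Implicit Defensive.

Import GRing.Theory.
Local Open Scope ring_scope.
Local Open Scope classical_set_scope.
Local Open Scope quotient_scope.

Section Ideals.
Variables (k : fieldType) (A : algType k).

Definition left_ideal (X : set A) : Prop :=
  [/\ X 0, forall x y, X x -> X y -> X (x + y) & forall a x, X x -> X (a * x)].

Definition two_sided_ideal (X : set A) : Prop :=
  left_ideal X /\ forall x a, X x -> X (x * a).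

Definition ideal_generated (X : set A) : set A :=
  [set a | forall K : set A, two_sided_ideal K -> X `<=` K -> K a].

Definition simple_algebra : Prop :=
  forall X : set A, two_sided_ideal X -> X = [set 0] \/ X = setT.

Definition left_artinian : Prop :=
  forall X : nat -> set A, (forall n, left_ideal (X n)) ->
    (forall n, X n.+1 `<=` X n) ->
    exists N, forall n, (N <= n)%N -> X n = X N.

Definition maximal_left_ideal (L : set A) : Prop :=
  [/\ left_ideal L, L <> setT &
      forall L', left_ideal L' -> L `<=` L' -> L' = L \/ L' = setT].

Definition jacobson_radical : set A :=
  [set a | forall L, maximal_left_ideal L -> L a].

Lemma left_idealN X x : left_ideal X -> X x -> X (- x).
Proof. by move=> [_ _ XM] Xx; rewrite -mulN1r; apply: XM. Qed.

Lemma left_ideal1 X : left_ideal X -> X 1 -> X = setT.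
Proof.
move=> [_ _ XM] X1; apply/seteqP; split=> // x _.
by rewrite -[x]mulr1; apply: XM.
Qed.

Lemma jacobson_ideal : two_sided_ideal jacobson_radical.
Proof.
split; first split.
- by move=> L [[L0 _ _] _ _].
- by move=> x y Jx Jy L mL; have [[_ LD _] _ _] := mL; apply: LD; [apply: Jx|apply: Jy].
- by move=> a x Jx L mL; have [[_ _ LM] _ _] := mL; apply: LM; apply: Jx.
move=> x a Jx L mL; have [lL LT mxL] := mL; have [L0 LD LM] := lL.
have [La|nLa] := pselect (L a); first exact: LM.
suff mLa : maximal_left_ideal [set y | L (y * a)] by apply: (Jx _ mLa).
split.
- split=> [|y z Ly Lz|b y Ly] /=; first by rewrite mul0r.
    by rewrite mulrDl; apply: LD.
  by rewrite -mulrA; apply: LM.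
- by move=> /seteqP[_ /(_ 1 I)] /=; rewrite mul1r.
move=> N lN LN; have [N0 ND NM] := lN.
have [NL|] := pselect (N `<=` [set y | L (y * a)]).
  by left; apply/seteqP.
move=> /existsNP[y /not_implyP[Ny nLy]]; right.
pose L2 : set A := [set z | exists l c, L l /\ z = l + c * (y * a)].
have lL2 : left_ideal L2.
  split.
  - by exists 0, 0; rewrite mul0r addr0.
  - move=> _ _ [l [c [Ll ->]]] [l' [c' [Ll' ->]]].
    by exists (l + l'), (c + c'); split; [exact: LD | rewrite mulrDl addrACA].
  - move=> b _ [l [c [Ll ->]]]; exists (b * l), (b * c).
    by split; [exact: LM | rewrite mulrDr mulrA].
have LL2 : L `<=` L2 by move=> l Ll; exists l, 0; rewrite mul0r addr0.
case: (mxL _ lL2 LL2) => L2E.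
  by case: nLy; rewrite /= -L2E; exists 0, 1; rewrite mul1r add0r.
apply/seteqP; split=> // z _.
have : L2 (z * a) by rewrite L2E.
move=> [l [c [Ll zaE]]].
have Nzc : N (z - c * y).
  by apply: LN; rewrite /= mulrBl zaE -mulrA addrK.
by rewrite -[z](subrK (c * y)); apply: ND => //; apply: NM.
Qed.

Lemma jacobson_proper : ~ jacobson_radical 1.
Proof.
pose P (X : set A) := X = set0 \/ left_ideal X /\ ~ X 1.
have [|X [PX mX]] := @Zorn_bigcup A P.
  move=> F FP tF.
  have [FX|noF] := pselect (exists X, F X /\ X !=set0); last first.
    left; apply/seteqP; split=> // x [X FX Xx]; apply: noF.
    by exists X; split=> //; exists x.
  have Flid X : F X -> X !=set0 -> left_ideal X /\ ~ X 1.
    by move=> FX0 [x Xx]; case: (FP _ FX0) => // X0; rewrite X0 in Xx.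
  have [X [FX0 X0]] := FX.
  right; split; last by move=> [Y FY Y1]; case: (Flid Y FY) => //; exists 1.
  split.
  - by exists X => //; case: (Flid X FX0 X0) => -[].
  - move=> x y [Y FY Yx] [Z FZ Zy].
    have [[_ YD _] _] := Flid Y FY (ex_intro _ x Yx).
    have [[_ ZD _] _] := Flid Z FZ (ex_intro _ y Zy).
    by case: (tF _ _ FY FZ) => sYZ; [exists Z|exists Y] => //;
      [apply: ZD => //; apply: sYZ | apply: YD => //; apply: sYZ].
  - move=> a x [Y FY Yx]; exists Y => //.
    by have [[_ _ YM] _] := Flid Y FY (ex_intro _ x Yx); apply: YM.
have P0 : P [set 0].
  right; split; last by move=> /eqP; rewrite oner_eq0.
  by split=> // [x y -> ->|a x ->] /=; rewrite ?addr0 ?mulr0.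
have [lX X1] : left_ideal X /\ ~ X 1.
  case: PX => // X0; case: (mX [set 0]) => //; rewrite X0; split=> //.
  by move=> /(_ 0 erefl).
move=> J1; apply: (X1); apply: J1; split=> //.
  by move=> XT; apply: X1; rewrite XT.
move=> L lL XL; have [L1|L1] := pselect (L 1).
  by right; apply: left_ideal1.
left; apply: contrapT => LX; apply: (mX L); last by right.
by split=> // LX'; apply: LX; apply/seteqP.
Qed.

End Ideals.

Section Span.
Variables (k : fieldType) (V : lmodType k).

Definition lspan (E : set V) : set V :=
  [set v | forall U : {pred V}, submod_closed U -> (forall x, E x -> x \in U) ->
           v \in U].

Definition lspan_pred (E : set V) : {pred V} := [pred v | `[< lspan E v >]].

Lemma lspan_predP E v : (v \in lspan_pred E) <-> lspan E v.
Proof. by split=> [/asboolP|/asboolP]. Qed.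

Lemma lspan_closed E : submod_closed (lspan_pred E).
Proof.
split=> [|c x y /lspan_predP Ex /lspan_predP Ey]; apply/lspan_predP.
  by move=> U [U0 _] _.
by move=> U cU EU; have [_ UD] := cU; apply: UD; [apply: Ex|apply: Ey].
Qed.

HB.instance Definition _ E :=
  GRing.isSubmodClosed.Build k V (lspan_pred E) (lspan_closed E).

Lemma mem_lspan (E : set V) x : E x -> x \in lspan_pred E.
Proof. by move=> Ex; apply/lspan_predP => U _; apply. Qed.

Lemma lspan_ind (E : set V) (U : {pred V}) : submod_closed U ->
  (forall x, E x -> x \in U) -> forall x, x \in lspan_pred E -> x \in U.
Proof. by move=> cU EU x /lspan_predP; apply. Qed.

End Span.

Section QuotientModule.
Variables (k : fieldType) (V : lmodType k) (W : submodClosed V).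

(* [submodClosed] does not inherit from [zmodClosed], which [Quotient.quot] needs. *)
Definition qmod_pred : {pred V} := fun v => v \in W.
Fact qmod_pred_closed : zmod_closed qmod_pred.
Proof. exact: GRing.submod_closedB (submodClosedP W). Qed.
HB.instance Definition _ := GRing.isZmodClosed.Build V qmod_pred qmod_pred_closed.

Definition qmod : Type := Quotient.quot qmod_pred.
HB.instance Definition _ := GRing.Zmodule.on qmod.

Definition qmod_pi (v : V) : qmod := \pi_(Quotient.quot qmod_pred) v.
Definition qmod_repr (q : qmod) : V := repr (q : Quotient.quot qmod_pred).

Lemma qmod_reprK q : qmod_pi (qmod_repr q) = q.
Proof. exact: reprK. Qed.

Lemma qmod_piP v w : qmod_pi v = qmod_pi w <-> v - w \in W.
Proof.
rewrite -[_ \in W]/(v - w \in qmod_pred) Quotient.idealrBE.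
by split=> /eqP.
Qed.

Lemma qmod_pi_additive : zmod_morphism qmod_pi.
Proof. by move=> x y; rewrite /qmod_pi !raddfB. Qed.

HB.instance Definition _ := GRing.isZmodMorphism.Build V qmod qmod_pi qmod_pi_additive.

Definition qmod_scale (c : k) (q : qmod) : qmod := qmod_pi (c *: qmod_repr q).

Lemma qmod_scaleE c v : qmod_scale c (qmod_pi v) = qmod_pi (c *: v).
Proof.
by apply/qmod_piP; rewrite -scalerBr rpredZ //; apply/qmod_piP; rewrite qmod_reprK.
Qed.

Fact qmod_scaleA a b q : qmod_scale a (qmod_scale b q) = qmod_scale (a * b) q.
Proof. by rewrite -[q]qmod_reprK !qmod_scaleE scalerA. Qed.
Fact qmod_scale1 : left_id 1 qmod_scale.
Proof. by move=> q; rewrite -[q]qmod_reprK qmod_scaleE scale1r. Qed.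
Fact qmod_scaleDr : right_distributive qmod_scale +%R.
Proof.
by move=> a q s; rewrite -[q]qmod_reprK -[s]qmod_reprK -raddfD !qmod_scaleE scalerDr raddfD.
Qed.
Fact qmod_scaleDl q : {morph qmod_scale^~ q : a b / a + b}.
Proof. by move=> a b; rewrite -[q]qmod_reprK !qmod_scaleE scalerDl raddfD. Qed.

HB.instance Definition _ := GRing.Zmodule_isLmodule.Build k qmod
  qmod_scaleA qmod_scale1 qmod_scaleDr qmod_scaleDl.

Fact qmod_pi_scalable : scalable qmod_pi.
Proof. by move=> c v; rewrite -qmod_scaleE. Qed.
HB.instance Definition _ := GRing.isScalable.Build k V qmod *:%R qmod_pi qmod_pi_scalable.

End QuotientModule.

Arguments qmod_pi {k V} W v.

Section QuotientAlgebra.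
Variables (k : fieldType) (A : algType k) (W : submodClosed A).

Definition proper_two_sided : Prop :=
  [/\ forall a x : A, x \in W -> a * x \in W,
      forall a x : A, x \in W -> x * a \in W & (1 : A) \notin W].

Variable idW : proper_two_sided.

Definition qalg & proper_two_sided : Type := qmod W.
Local Notation Q := (qalg idW).
HB.instance Definition _ := GRing.Lmodule.on Q.

Definition qalg_pi (a : A) : Q := qmod_pi W a.

Lemma qalg_piP a b : qalg_pi a = qalg_pi b <-> a - b \in W.
Proof. exact: qmod_piP. Qed.

Definition qalg_mul (p q : Q) : Q := qalg_pi (qmod_repr p * qmod_repr q).

Lemma qalg_mulE a b : qalg_mul (qalg_pi a) (qalg_pi b) = qalg_pi (a * b).
Proof.
have [WM MW _] := idW; apply/qmod_piP.
set a' := qmod_repr _; set b' := qmod_repr _.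
have -> : a' * b' - a * b = a' * (b' - b) + (a' - a) * b.
  by rewrite mulrBr mulrBl addrA subrK.
by apply: rpredD; [apply: WM|apply: MW]; apply/qmod_piP; rewrite qmod_reprK.
Qed.

Lemma qalg_ind (P : Q -> Prop) : (forall a, P (qalg_pi a)) -> forall q, P q.
Proof. by move=> PA q; rewrite -[q]qmod_reprK; apply: PA. Qed.

Fact qalg_mulA : associative qalg_mul.
Proof. by elim/qalg_ind=> a; elim/qalg_ind=> b; elim/qalg_ind=> c; rewrite !qalg_mulE mulrA. Qed.
Fact qalg_mul1 : left_id (qalg_pi 1) qalg_mul.
Proof. by elim/qalg_ind=> a; rewrite qalg_mulE mul1r. Qed.
Fact qalg_1mul : right_id (qalg_pi 1) qalg_mul.
Proof. by elim/qalg_ind=> a; rewrite qalg_mulE mulr1. Qed.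
Fact qalg_piD a b : qalg_pi (a + b) = qalg_pi a + qalg_pi b.
Proof. exact: (raddfD (qmod_pi W)). Qed.
Fact qalg_mulDl : left_distributive qalg_mul +%R.
Proof.
by elim/qalg_ind=> a; elim/qalg_ind=> b; elim/qalg_ind=> c; rewrite -qalg_piD !qalg_mulE mulrDl qalg_piD.
Qed.
Fact qalg_mulDr : right_distributive qalg_mul +%R.
Proof.
by elim/qalg_ind=> a; elim/qalg_ind=> b; elim/qalg_ind=> c; rewrite -qalg_piD !qalg_mulE mulrDr qalg_piD.
Qed.
Fact qalg_1neq0 : qalg_pi 1 != 0.
Proof.
have [_ _ W1] := idW; apply: contra W1 => /eqP; rewrite -[0](raddf0 (qmod_pi W)).
by move/qmod_piP; rewrite subr0.
Qed.

HB.instance Definition _ := GRing.Zmodule_isNzRing.Build Q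
  qalg_mulA qalg_mul1 qalg_1mul qalg_mulDl qalg_mulDr qalg_1neq0.

Lemma qalg_piZ c a : qalg_pi (c *: a) = c *: qalg_pi a.
Proof. exact: (linearZZ (qmod_pi W)). Qed.
Fact qalg_scalerAl c (p q : Q) : c *: (p * q) = (c *: p) * q.
Proof.
by elim/qalg_ind: p => a; elim/qalg_ind: q => b; rewrite -qalg_piZ [LHS](congr1 _ (qalg_mulE _ _)) -qalg_piZ [RHS]qalg_mulE scalerAl.
Qed.
Fact qalg_scalerAr c (p q : Q) : c *: (p * q) = p * (c *: q).
Proof.
by elim/qalg_ind: p => a; elim/qalg_ind: q => b; rewrite -qalg_piZ [LHS](congr1 _ (qalg_mulE _ _)) -qalg_piZ [RHS]qalg_mulE scalerAr.
Qed.
HB.instance Definition _ := GRing.Lmodule_isLalgebra.Build k Q qalg_scalerAl.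
HB.instance Definition _ := GRing.Lalgebra_isAlgebra.Build k Q qalg_scalerAr.

Fact qalg_pi_linear : linear qalg_pi.
Proof. by move=> c a b; rewrite qalg_piD qalg_piZ. Qed.
Fact qalg_pi_monoid : monoid_morphism qalg_pi.
Proof. by split=> // a b; rewrite -qalg_mulE. Qed.
HB.instance Definition _ := GRing.isLinear.Build k A Q *:%R qalg_pi qalg_pi_linear.
HB.instance Definition _ := GRing.isMonoidMorphism.Build A Q qalg_pi qalg_pi_monoid.

End QuotientAlgebra.

(* [k]-central [R]-[S]-bimodules. *)
Record bimod (k : fieldType) (R S : algType k) := Bimod {
  bcar :> lmodType k;
  lact : R -> bcar -> bcar;
  ract : bcar -> S -> bcar;
  lact_linl : forall v, linear (lact^~ v);
  lact_linr : forall a, linear (lact a);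
  lact1 : forall v, lact 1 v = v;
  lactM : forall a b v, lact (a * b) v = lact a (lact b v);
  ract_linl : forall s, linear (ract^~ s);
  ract_linr : forall v, linear (ract v);
  ract1 : forall v, ract v 1 = v;
  ractM : forall v s t, ract v (s * t) = ract (ract v s) t;
  lractA : forall a v s, ract (lact a v) s = lact a (ract v s) }.

Section Regular.
Variables (k : fieldType) (R : algType k).

Fact mulr_linr (a : R) : linear ( *%R a).
Proof. by move=> c x y; rewrite mulrDr scalerAr. Qed.
Fact mulr_linl (a : R) : linear ( *%R^~ a).
Proof. by move=> c x y; rewrite mulrDl scalerAl. Qed.
Fact scale_linr (c : k) : linear (fun v : R => c *: v).
Proof. by move=> d x y; rewrite scalerDr !scalerA mulrC. Qed.
Fact scale_linl (v : R) : linear (fun c : k^o => c *: v).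
Proof. by move=> d x y; rewrite scalerDl scalerA. Qed.

Definition regular_bimod : bimod R R :=
  @Bimod k R R R *%R *%R mulr_linl mulr_linr (@mul1r R)
    (fun a b v => esym (mulrA a b v)) mulr_linl mulr_linr (@mulr1 R) (@mulrA R)
    (fun a v s => esym (mulrA a v s)).

Definition left_regular : bimod R k^o.
Proof.
refine (@Bimod k R k^o R *%R (fun v (c : k^o) => c *: v) mulr_linl mulr_linr
  (@mul1r R) (fun a b v => esym (mulrA a b v)) scale_linr scale_linl
  (@scale1r k R) _ _).
- by move=> v s t; rewrite scalerA mulrC.
- by move=> a v s; rewrite scalerAr.
Defined.

Definition right_regular : bimod k^o R.
Proof.
refine (@Bimod k k^o R R (fun (c : k^o) v => c *: v) *%R scale_linl scale_linr
  (@scale1r k R) _ mulr_linl mulr_linr (@mulr1 R) (@mulrA R) _).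
- by move=> a b v; rewrite scalerA.
- by move=> a v s; rewrite scalerAl.
Defined.

End Regular.

Section TensorProduct.
Variables (k : fieldType) (R S Q : algType k) (M : bimod R S) (N : bimod S Q).

Definition tens_free : Type := {freeg (M * N)%type / k}.
HB.instance Definition _ := GRing.Lmodule.on tens_free.

Definition tens_gen (x : M) (y : N) : tens_free := Freeg [:: (1, (x, y))].

(* [M (x)_S N] is the free [k]-module on [M * N] modulo these relations;
   homogeneity in [y] follows from [TensZ] and [TensA] by [k]-centrality. *)
Inductive tens_rel : set tens_free :=
| TensDl x x' y : tens_rel (tens_gen (x + x') y - tens_gen x y - tens_gen x' y)
| TensDr x y y' : tens_rel (tens_gen x (y + y') - tens_gen x y - tens_gen x y')
| TensZ c x y : tens_rel (tens_gen (c *: x) y - c *: tens_gen x y)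
| TensA x s y : tens_rel (tens_gen (ract x s) y - tens_gen x (lact s y)).

Definition tens : Type := qmod (lspan_pred tens_rel).
HB.instance Definition _ := GRing.Lmodule.on tens.

Definition tmul (x : M) (y : N) : tens :=
  qmod_pi (lspan_pred tens_rel) (tens_gen x y).

Let pi := qmod_pi (lspan_pred tens_rel).

Let tens_relE u v w : tens_rel (u - v - w) -> pi u = pi v + pi w.
Proof. by move=> r; rewrite -raddfD; apply/qmod_piP; rewrite opprD addrA mem_lspan. Qed.

Lemma tmulDl x x' y : tmul (x + x') y = tmul x y + tmul x' y.
Proof. exact/tens_relE/TensDl. Qed.
Lemma tmulDr x y y' : tmul x (y + y') = tmul x y + tmul x y'.
Proof. exact/tens_relE/TensDr. Qed.
Lemma tmulZl c x y : tmul (c *: x) y = c *: tmul x y.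
Proof. by rewrite -linearZ; apply/qmod_piP/mem_lspan/TensZ. Qed.
Lemma tmulA x s y : tmul (ract x s) y = tmul x (lact s y).
Proof. exact/qmod_piP/mem_lspan/TensA. Qed.

Lemma tmulZr c x y : tmul x (c *: y) = c *: tmul x y.
Proof.
have lactZ : lact c%:A y = c *: y.
  by have /= := lact_linl y c 1 0; rewrite addr0 lact1 => ->; have /= := lact_linl y (-1) 0 0; rewrite scaler0 addr0 scaleN1r addNr => ->; rewrite addr0.
have ractZ : ract x c%:A = c *: x.
  by have /= := ract_linr x c 1 0; rewrite addr0 ract1 => ->; have /= := ract_linr x (-1) 0 0; rewrite scaler0 addr0 scaleN1r addNr => ->; rewrite addr0.
by rewrite -lactZ -tmulA ractZ tmulZl.
Qed.

Lemma tens_ind (P : tens -> Prop) :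
  (forall x y, P (tmul x y)) -> (forall u v, P u -> P v -> P (u + v)) ->
  forall t, P t.
Proof.
move=> Pt PD t; rewrite -[t]qmod_reprK; set D := qmod_repr t.
rewrite -[D](@freeg_sumE k _ D) raddf_sum /=.
have P0 : P 0 by rewrite -[0](scale0r (tmul 0 0)) -tmulZl.
elim/big_ind: _ => // -[x y] _; have -> : Freeg [:: (coeff (x, y) D, (x, y))] = coeff (x, y) D *: tens_gen x y.
  by apply/eqP/freeg_eqP => z; rewrite coeffZ !coeffU mul1r.
by rewrite linearZ /= -/(tmul x y) -tmulZl.
Qed.

Section Lift.
Variables (L : lmodType k) (f : M -> N -> L).

Definition balanced : Prop :=
  [/\ forall y, linear (f^~ y), forall x, linear (f x) &
      forall x s y, f (ract x s) y = f x (lact s y)].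

(* The linear map induced by [f]; meaningful when [f] is [balanced]. *)
Definition tlift (t : tens) : L := fglift (fun p => f p.1 p.2) (qmod_repr t).

Fact fglift_linear : linear (fglift (fun p => f p.1 p.2) : tens_free -> L).
Proof.
set g := fglift _.
have gB : {morph g : x y / x - y} by exact: lift_is_additive.
have g0 : g 0 = 0 by rewrite -[0 in LHS](subrr 0) gB subrr.
have gD : {morph g : x y / x + y}.
  by move=> x y; rewrite -{1}[y]opprK gB -[- y]sub0r gB g0 sub0r opprK.
have gS (r : seq (M * N)) F : g (\sum_(i <- r) F i) = \sum_(i <- r) g (F i).
  by elim: r => [|i r IH]; rewrite ?big_nil // !big_cons gD IH.
move=> c x y; rewrite gD; congr (_ + _).
have -> : g x = \sum_(z <- dom x) coeff z x *: f z.1 z.2.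
  rewrite -[in LHS](@freeg_sumE k _ x) gS.
  by apply: eq_bigr => z _; rewrite /g liftU.
rewrite scaler_sumr [LHS]gS.
by apply: eq_bigr => z _; rewrite /g liftU scalerA.
Qed.

Hypothesis f_bal : balanced.

Lemma tlift_pi D : tlift (pi D) = fglift (fun p => f p.1 p.2) D.
Proof.
have [fl fr fA] := f_bal; pose g := fglift (fun p => f p.1 p.2) : tens_free -> L.
have gU x' y' : g (tens_gen x' y') = f x' y' by rewrite /g liftU scale1r.
pose G : {linear tens_free -> L} :=
  HB.pack g (GRing.isLinear.Build k _ _ _ g fglift_linear).
pose U : {pred tens_free} := [pred v | G v == 0].
have cU : submod_closed U.
  split=> [|c u v]; rewrite !inE ?raddf0 // => /eqP Gu /eqP Gv.
  by rewrite linearP Gu Gv scaler0 addr0.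
pose F y' : {linear M -> L} :=
  HB.pack (f^~ y') (GRing.isLinear.Build k _ _ _ (f^~ y') (fl y')).
pose F' x' : {linear N -> L} :=
  HB.pack (f x') (GRing.isLinear.Build k _ _ _ (f x') (fr x')).
have fDl x x' y : f (x + x') y = f x y + f x' y := raddfD (F y) x x'.
have fDr x y y' : f x (y + y') = f x y + f x y' := raddfD (F' x) y y'.
have fZl c x y : f (c *: x) y = c *: f x y := linearZZ (F y) c x.
have gZ c u : g (c *: u) = c *: g u := linearZZ G c u.
have relU v : tens_rel v -> v \in U.
  case=> *; rewrite inE ?raddfB /= ?gZ !gU -?fA ?subrr //.
  - by rewrite fDl -addrA -opprD subrr.
  - by rewrite fDr -addrA -opprD subrr.
  - by rewrite fZl subrr.
have : qmod_repr (pi D) - D \in lspan_pred tens_rel.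
  by apply/qmod_piP; rewrite qmod_reprK.
by move/(lspan_ind cU relU); rewrite inE raddfB subr_eq0 => /eqP.
Qed.

Lemma tliftE x y : tlift (tmul x y) = f x y.
Proof. by rewrite tlift_pi liftU scale1r. Qed.

Lemma tlift_linear : linear tlift.
Proof.
move=> c u v; rewrite -[u]qmod_reprK -[v]qmod_reprK -linearP !tlift_pi.
exact: fglift_linear.
Qed.

End Lift.
End TensorProduct.

Section LinearFacts.
Variables (k : fieldType) (U V : lmodType k) (f : U -> V).
Hypothesis fl : linear f.
Let F : {linear U -> V} := HB.pack f (GRing.isLinear.Build k _ _ _ f fl).
Lemma lin0 : f 0 = 0. Proof. exact: (raddf0 F). Qed.
Lemma linD x y : f (x + y) = f x + f y. Proof. exact: (raddfD F). Qed.
Lemma linB x y : f (x - y) = f x - f y. Proof. exact: (raddfB F). Qed.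
Lemma linZ c x : f (c *: x) = c *: f x. Proof. exact: (linearZZ F). Qed.
Lemma lin_sum I (r : seq I) P G :
  f (\sum_(i <- r | P i) G i) = \sum_(i <- r | P i) f (G i).
Proof. exact: (raddf_sum F). Qed.
End LinearFacts.

Section TensorBimodule.
Variables (k : fieldType) (R S Q : algType k) (M : bimod R S) (N : bimod S Q).
Local Notation T := (tens M N).

Definition tens_lact (a : R) : T -> T :=
  tlift (fun x y => tmul (lact a x) y).
Definition tens_ract (t : T) (q : Q) : T :=
  tlift (fun x y => tmul x (ract y q)) t.

Fact tmul_linl (y : N) : linear (fun x : M => tmul x y).
Proof. by move=> c u v; rewrite tmulDl tmulZl. Qed.
Fact tmul_linr (x : M) : linear (fun y : N => tmul x y).
Proof. by move=> c u v; rewrite tmulDr tmulZr. Qed.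

Fact tens_lact_balanced a : balanced (fun (x : M) (y : N) => tmul (lact a x) y).
Proof.
split=> [y|x|x s y].
- by move=> c u v; rewrite (lact_linr a) tmul_linl.
- exact: tmul_linr.
- by rewrite -lractA tmulA.
Qed.
Fact tens_ract_balanced q : balanced (fun (x : M) (y : N) => tmul x (ract y q)).
Proof.
split=> [y|x|x s y].
- exact: tmul_linl.
- by move=> c u v; rewrite (ract_linl q) tmul_linr.
- by rewrite tmulA lractA.
Qed.

Lemma tens_lactE a x y : tens_lact a (tmul x y) = tmul (lact a x) y.
Proof. exact/tliftE/tens_lact_balanced. Qed.
Lemma tens_ractE x y q : tens_ract (tmul x y) q = tmul x (ract y q).
Proof. exact/tliftE/tens_ract_balanced. Qed.
Fact tens_lact_linr a : linear (tens_lact a).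
Proof. exact/tlift_linear/tens_lact_balanced. Qed.
Fact tens_ract_linl q : linear (tens_ract^~ q).
Proof. exact/tlift_linear/tens_ract_balanced. Qed.

Fact tens_lact_linl t : linear (tens_lact^~ t).
Proof.
move=> c a b; elim/tens_ind: t => [x y|u v IHu IHv].
  by rewrite !tens_lactE lact_linl tmul_linl.
by rewrite !(linD (tens_lact_linr _)) IHu IHv scalerDr addrACA.
Qed.
Fact tens_ract_linr t : linear (tens_ract t).
Proof.
move=> c a b; elim/tens_ind: t => [x y|u v IHu IHv].
  by rewrite !tens_ractE ract_linr tmul_linr.
by rewrite !(linD (tens_ract_linl _)) IHu IHv scalerDr addrACA.
Qed.
Fact tens_lact1 t : tens_lact 1 t = t.
Proof.
elim/tens_ind: t => [x y|u v IHu IHv]; first by rewrite tens_lactE lact1.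
by rewrite (linD (tens_lact_linr _)) IHu IHv.
Qed.
Fact tens_lactM a b t : tens_lact (a * b) t = tens_lact a (tens_lact b t).
Proof.
elim/tens_ind: t => [x y|u v IHu IHv]; first by rewrite !tens_lactE lactM.
by rewrite !(linD (tens_lact_linr _)) IHu IHv.
Qed.
Fact tens_ract1 t : tens_ract t 1 = t.
Proof.
elim/tens_ind: t => [x y|u v IHu IHv]; first by rewrite tens_ractE ract1.
by rewrite (linD (tens_ract_linl _)) IHu IHv.
Qed.
Fact tens_ractM t a b : tens_ract t (a * b) = tens_ract (tens_ract t a) b.
Proof.
elim/tens_ind: t => [x y|u v IHu IHv]; first by rewrite !tens_ractE ractM.
by rewrite !(linD (tens_ract_linl _)) IHu IHv.
Qed.
Fact tens_lractA a t q : tens_ract (tens_lact a t) q = tens_lact a (tens_ract t q).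
Proof.
elim/tens_ind: t => [x y|u v IHu IHv].
  by rewrite tens_lactE !tens_ractE tens_lactE.
by rewrite !(linD (tens_lact_linr _), linD (tens_ract_linl _)) IHu IHv.
Qed.

Definition tens_bimod : bimod R Q :=
  @Bimod k R Q T tens_lact tens_ract tens_lact_linl tens_lact_linr
    tens_lact1 tens_lactM tens_ract_linl tens_ract_linr tens_ract1 tens_ractM
    tens_lractA.

End TensorBimodule.

Section DependentProduct.
Variables (k : fieldType) (I : Type) (V : I -> lmodType k).

Definition dprod : Type := forall i, V i.
HB.instance Definition _ := Choice.copy dprod (forall i, V i).

Implicit Types f g : dprod.
Definition dprod_zero : dprod := fun=> 0.
Definition dprod_opp f : dprod := fun i => - f i.
Definition dprod_add f g : dprod := fun i => f i + g i.
Definition dprod_scale (c : k) f : dprod := fun i => c *: f i.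

Fact dprod_addA : associative dprod_add.
Proof. by move=> f g h; apply: functional_extensionality_dep => i; apply: addrA. Qed.
Fact dprod_addC : commutative dprod_add.
Proof. by move=> f g; apply: functional_extensionality_dep => i; apply: addrC. Qed.
Fact dprod_add0 : left_id dprod_zero dprod_add.
Proof. by move=> f; apply: functional_extensionality_dep => i; apply: add0r. Qed.
Fact dprod_addN : left_inverse dprod_zero dprod_opp dprod_add.
Proof. by move=> f; apply: functional_extensionality_dep => i; apply: addNr. Qed.
HB.instance Definition _ := GRing.isZmodule.Build dprod
  dprod_addA dprod_addC dprod_add0 dprod_addN.

Fact dprod_scaleA a b f : dprod_scale a (dprod_scale b f) = dprod_scale (a * b) f.
Proof. by apply: functional_extensionality_dep => i; apply: scalerA. Qed.
Fact dprod_scale1 : left_id 1 dprod_scale.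
Proof. by move=> f; apply: functional_extensionality_dep => i; apply: scale1r. Qed.
Fact dprod_scaleDr : right_distributive dprod_scale +%R.
Proof. by move=> a f g; apply: functional_extensionality_dep => i; apply: scalerDr. Qed.
Fact dprod_scaleDl f : {morph dprod_scale^~ f : a b / a + b}.
Proof. by move=> a b; apply: functional_extensionality_dep => i; apply: scalerDl. Qed.
HB.instance Definition _ := GRing.Zmodule_isLmodule.Build k dprod
  dprod_scaleA dprod_scale1 dprod_scaleDr dprod_scaleDl.

End DependentProduct.

Section AlgebraProduct.
Variables (k : fieldType) (I : Type) (A : I -> algType k) (I0 : inhabited I).

(* [I0] is only there because an [algType] is nontrivial. *)
Definition aprod & inhabited I : Type := dprod A.
Local Notation P := (aprod I0).
HB.instance Definition _ := GRing.Lmodule.on P.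

Definition aprod_one : P := fun=> 1.
Definition aprod_mul (f g : P) : P := fun i => f i * g i.

Fact aprod_mulA : associative aprod_mul.
Proof. by move=> f g h; apply: functional_extensionality_dep => i; apply: mulrA. Qed.
Fact aprod_mul1 : left_id aprod_one aprod_mul.
Proof. by move=> f; apply: functional_extensionality_dep => i; apply: mul1r. Qed.
Fact aprod_1mul : right_id aprod_one aprod_mul.
Proof. by move=> f; apply: functional_extensionality_dep => i; apply: mulr1. Qed.
Fact aprod_mulDl : left_distributive aprod_mul +%R.
Proof. by move=> f g h; apply: functional_extensionality_dep => i; apply: mulrDl. Qed.
Fact aprod_mulDr : right_distributive aprod_mul +%R.
Proof. by move=> f g h; apply: functional_extensionality_dep => i; apply: mulrDr. Qed.
Fact aprod_1neq0 : aprod_one != 0.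
Proof.
by case: I0 => i; apply/eqP => /(congr1 (fun f : P => f i)) /eqP; rewrite oner_eq0.
Qed.
HB.instance Definition _ := GRing.Zmodule_isNzRing.Build P
  aprod_mulA aprod_mul1 aprod_1mul aprod_mulDl aprod_mulDr aprod_1neq0.

Fact aprod_scalerAl c (f g : P) : c *: (f * g) = (c *: f) * g.
Proof. by apply: functional_extensionality_dep => i; apply: scalerAl. Qed.
Fact aprod_scalerAr c (f g : P) : c *: (f * g) = f * (c *: g).
Proof. by apply: functional_extensionality_dep => i; apply: scalerAr. Qed.
HB.instance Definition _ := GRing.Lmodule_isLalgebra.Build k P aprod_scalerAl.
HB.instance Definition _ := GRing.Lalgebra_isAlgebra.Build k P aprod_scalerAr.

End AlgebraProduct.

Section TensorAlgebra.
Variables (k : fieldType) (R : algType k) (M : bimod R R).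

(* [M^(x)(n+1)] is [M (x) M^(x)n], and [M^(x)0] is [R]. *)
Fixpoint tpow (n : nat) : bimod R R :=
  if n is n'.+1 then tens_bimod M (tpow n') else regular_bimod R.

Definition tsupp : {pred dprod tpow} :=
  [pred f : dprod tpow | `[< exists N, forall n, (N <= n)%N -> f n = 0 >]].

Lemma tsuppP f : (f \in tsupp) <-> exists N, forall n, (N <= n)%N -> f n = 0.
Proof. by split=> /asboolP. Qed.

Fact tsupp_closed : submod_closed tsupp.
Proof.
split=> [|c f g /tsuppP[N fN] /tsuppP[N' gN]]; apply/tsuppP; first by exists 0%N.
exists (maxn N N') => n; rewrite geq_max => /andP[Nn N'n].
by rewrite -[LHS]/(c *: f n + g n) fN // gN // scaler0 addr0.
Qed.
HB.instance Definition _ := GRing.isSubmodClosed.Build k (dprod tpow) tsupp tsupp_closed.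

(* The direct sum of the [tpow n]: finitely supported families. *)
Record talg : Type := TAlg { tcomp : dprod tpow; _ : tcomp \in tsupp }.
Definition tcoef (f : talg) : forall n, tpow n := tcomp f.
Coercion tcoef : talg >-> Funclass.
HB.instance Definition _ := [isSub for tcomp].
HB.instance Definition _ := [Choice of talg by <:].
HB.instance Definition _ := [SubChoice_isSubLmodule of talg by <:].

Lemma talgP (f g : talg) : (forall n, f n = g n) -> f = g.
Proof. by move=> fg; apply/val_inj/functional_extensionality_dep. Qed.
Lemma tcomp_supp (f : talg) : exists N, forall n, (N <= n)%N -> f n = 0.
Proof. exact/tsuppP/(valP f). Qed.
Lemma tcompP c (f g : talg) n : (c *: f + g) n = c *: f n + g n. Proof. by []. Qed.
Lemma tcompD (f g : talg) n : (f + g) n = f n + g n. Proof. by []. Qed.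
Lemma tcomp0 n : (0 : talg) n = 0. Proof. by []. Qed.
Lemma tcomp_sum I (r : seq I) P (F : I -> talg) n :
  (\sum_(i <- r | P i) F i) n = \sum_(i <- r | P i) F i n.
Proof. by elim/big_rec2: _ => // i x y _ <-. Qed.

(* The inclusion of the [n]-th summand in a direct sum. *)
Fixpoint dirac (V : nat -> lmodType k) (n : nat) : V n -> forall m, V m :=
  match n with
  | 0 => fun x m => match m with 0 => x | _.+1 => 0 end
  | n'.+1 => fun x m =>
      match m with 0 => 0 | m'.+1 => @dirac (fun i => V i.+1) n' x m' end
  end.

Lemma dirac_eq (V : nat -> lmodType k) n (x : V n) : dirac x n = x.
Proof. by elim: n V x => //= n IH V x; apply: (IH (fun i => V i.+1)). Qed.
Lemma dirac_neq (V : nat -> lmodType k) n (x : V n) m : m != n -> dirac x m = 0.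
Proof.
by elim: n V x m => [|n IH] V x [|m] //= mn; apply: (IH (fun i => V i.+1)).
Qed.
Lemma dirac_nat (V W : nat -> lmodType k) (p : forall n, V n -> W n) n (x : V n) m :
  (forall n, p n 0 = 0) -> dirac (p n x) m = p m (dirac x m).
Proof.
move=> p0; elim: n V W p p0 x m => [|n IH] V W p p0 x [|m] //=.
exact: (IH (fun i => V i.+1) (fun i => W i.+1) (fun i => p i.+1)).
Qed.

Fact tin_supp n (x : tpow n) : (dirac x : dprod tpow) \in tsupp.
Proof.
by apply/tsuppP; exists n.+1 => m nm; rewrite dirac_neq // neq_ltn nm orbT.
Qed.
Definition tin n (x : tpow n) : talg := TAlg (tin_supp x).

Fact tlmul_supp (a : R) (f : talg) :
  (fun n => lact a (f n) : tpow n) \in tsupp.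
Proof.
apply/tsuppP; have [N fN] := tcomp_supp f; exists N => n /fN ->.
exact/lin0/lact_linr.
Qed.
Definition tlmul (a : R) (f : talg) : talg := TAlg (tlmul_supp a f).

Definition tshift_fun (x : M) (f : talg) (n : nat) : tpow n :=
  if n is n'.+1 then tmul x (f n') else 0.
Fact tshift_supp (x : M) (f : talg) : tshift_fun x f \in tsupp.
Proof.
apply/tsuppP; have [N fN] := tcomp_supp f; exists N.+1 => -[//|n] /fN /= ->.
exact/lin0/tmul_linr.
Qed.
Definition tshift (x : M) (f : talg) : talg := TAlg (tshift_supp x f).

(* Left concatenation with a homogeneous tensor:
   [tact (x1 (x) ... (x) xn (x) a) g] is [x1 (x) ... (x) xn (x) (a g)]. *)
Fixpoint tact (n : nat) : tpow n -> talg -> talg :=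
  match n with
  | 0 => fun a g => tlmul a g
  | n'.+1 => fun t g =>
      tlift (fun (x : M) (t' : tpow n') => tshift x (tact t' g)) (t : tens M (tpow n'))
  end.

Definition tbound (f : talg) : nat := projT1 (cid (tcomp_supp f)).
Definition tprod (f g : talg) : talg := \sum_(n < tbound f) tact (f n) g.
Definition tone : talg := @tin 0 (1 : R).

Fact tlmul_linr a : linear (tlmul a).
Proof. by move=> c f g; apply: talgP => n; apply: lact_linr. Qed.
Fact tlmul_linl f : linear (tlmul^~ f).
Proof. by move=> c a b; apply: talgP => n; apply: lact_linl. Qed.
Fact tshift_linr x : linear (tshift x).
Proof.
move=> c f g; apply: talgP => -[|n]; rewrite tcompP /=; first by rewrite scaler0 addr0.
exact: tmul_linr.
Qed.
Fact tshift_linl f : linear (tshift^~ f).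
Proof.
move=> c x y; apply: talgP => -[|n]; rewrite tcompP /=; first by rewrite scaler0 addr0.
exact: tmul_linl.
Qed.

Fact tact_lin_lact n : (forall g, linear (fun t : tpow n => tact t g)) /\
  (forall a (t : tpow n) g, tact (lact a t) g = tlmul a (tact t g)).
Proof.
elim: n => [|n [IHl IHa]].
  split=> [g|a t g]; first exact: tlmul_linl.
  by apply: talgP => n; apply: lactM.
have bal g : balanced (fun (x : M) (t : tpow n) => tshift x (tact t g)).
  split=> [t|x|x a t].
  - exact: tshift_linl.
  - by move=> c u v; rewrite (IHl g) tshift_linr.
  - by rewrite IHa; apply: talgP => -[//|m] /=; apply: tmulA.
have tl g : linear (fun t : tpow n.+1 => tact t g) := tlift_linear (bal g).
split=> // a t g.
elim/tens_ind: t => [x t|u v IHu IHv].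
  rewrite /= tens_lactE !(tliftE (bal g)).
  by apply: talgP => -[|m] /=; rewrite ?(lin0 (lact_linr _)) // ?mulr0 // -?tens_lactE.
by rewrite (linD (lact_linr _)) !(linD (tl g)) IHu IHv (linD (tlmul_linr _)).
Qed.

Fact tact_linl n g : linear (fun t : tpow n => tact t g).
Proof. by have [] := tact_lin_lact n. Qed.
Fact tact_lact n a (t : tpow n) g : tact (lact a t) g = tlmul a (tact t g).
Proof. by have [] := tact_lin_lact n. Qed.
Fact tact_balanced n g : balanced (fun (x : M) (t : tpow n) => tshift x (tact t g)).
Proof.
split=> [t|x|x a t].
- exact: tshift_linl.
- by move=> c u v; rewrite (tact_linl g) tshift_linr.
- by rewrite tact_lact; apply: talgP => -[//|m] /=; apply: tmulA.
Qed.
Lemma tactS n x (t : tpow n) g : tact (tmul x t : tpow n.+1) g = tshift x (tact t g).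
Proof. exact: (tliftE (@tact_balanced n g)). Qed.

Fact tact_linr n (t : tpow n) : linear (tact t).
Proof.
elim: n t => [|n IH] t; first exact: tlmul_linr.
elim/tens_ind: t => [x t|u v IHu IHv] c f g; first by rewrite !tactS IH tshift_linr.
by rewrite !(linD (@tact_linl n.+1 _)) IHu IHv scalerDr addrACA.
Qed.

Lemma tprodE N (f g : talg) : (forall n, (N <= n)%N -> f n = 0) ->
  tprod f g = \sum_(n < N) tact (f n) g.
Proof.
have widen N1 N2 : (forall n, (N1 <= n)%N -> f n = 0) -> (N1 <= N2)%N ->
    \sum_(n < N1) tact (f n) g = \sum_(n < N2) tact (f n) g.
  move=> f0 N12; rewrite (big_ord_widen N2 (fun n => tact (f n) g)) // big_mkcond /=.
  apply: eq_bigr => i _; case: ltnP => // /f0 ->.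
  by rewrite (lin0 (tact_linl g)).
move=> fN; rewrite /tprod /tbound; case: (cid _) => /= B fB.
by rewrite (widen _ (maxn B N)) ?leq_maxl // -(widen N) ?leq_maxr.
Qed.

Fact tprodDl : left_distributive tprod +%R.
Proof.
move=> f g h; have [N fN] := tcomp_supp f; have [N' gN] := tcomp_supp g.
have fM n : (maxn N N' <= n)%N -> f n = 0 by rewrite geq_max => /andP[/fN].
have gM n : (maxn N N' <= n)%N -> g n = 0 by rewrite geq_max => /andP[_ /gN].
rewrite (tprodE h fM) (tprodE h gM) (@tprodE (maxn N N')) => [|n Mn].
  by rewrite -big_split; apply: eq_bigr => i _; rewrite (linD (tact_linl h)).
by rewrite tcompD fM // gM // addr0.
Qed.
Fact tprod_linr f : linear (tprod f).
Proof.
move=> c g h; rewrite /tprod scaler_sumr -big_split.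
by apply: eq_bigr => i _; rewrite tact_linr.
Qed.
Fact tprodDr : right_distributive tprod +%R.
Proof. by move=> f g h; rewrite (linD (tprod_linr f)). Qed.
Fact tprodZl c f g : c *: tprod f g = tprod (c *: f) g.
Proof.
have [N fN] := tcomp_supp f; rewrite (tprodE g fN) (@tprodE N) => [|n Mn].
  rewrite scaler_sumr; apply: eq_bigr => i _.
  by rewrite -(linZ (tact_linl g)).
by rewrite -[LHS]/(c *: f n) fN // scaler0.
Qed.

Fact tprod_tlmul a f g : tprod (tlmul a f) g = tlmul a (tprod f g).
Proof.
have [N fN] := tcomp_supp f; rewrite (tprodE g fN) (@tprodE N) => [|n /fN /= ->].
  by rewrite (lin_sum (tlmul_linr a)); apply: eq_bigr => i _; rewrite tact_lact.
exact/lin0/lact_linr.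
Qed.
Fact tprod_tshift x f g : tprod (tshift x f) g = tshift x (tprod f g).
Proof.
have [N fN] := tcomp_supp f.
rewrite (tprodE g fN) (@tprodE N.+1) => [|[//|n] /fN /= ->].
  rewrite big_ord_recl (lin0 (@tact_linl 0 g)) add0r (lin_sum (tshift_linr x)).
  by apply: eq_bigr => i _; rewrite -tactS.
exact/lin0/tmul_linr.
Qed.
Fact tprod_tact n (t : tpow n) f g : tprod (tact t f) g = tact t (tprod f g).
Proof.
elim: n t => [|n IH] t; first exact: tprod_tlmul.
elim/tens_ind: t => [x t|u v IHu IHv]; first by rewrite !tactS tprod_tshift IH.
by rewrite !(linD (@tact_linl n.+1 _)) tprodDl IHu IHv.
Qed.
Fact tprodA : associative tprod.
Proof.
move=> f g h; have [N fN] := tcomp_supp f.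
rewrite !(tprodE _ fN).
elim/big_rec2: _ => [|i x y _ IH]; first by rewrite (@tprodE 0) ?big_ord0.
by rewrite tprodDl -IH tprod_tact.
Qed.

Lemma tin_tmul n x (t : tpow n) : tin (tmul x t : tpow n.+1) = tshift x (tin t).
Proof.
apply: talgP => -[//|m] /=.
exact: (@dirac_nat tpow (fun i => tens_bimod M (tpow i)) (fun i t => tmul x t) n t m
  (fun i => lin0 (tmul_linr _))).
Qed.
Lemma tin_lin n : linear (@tin n).
Proof.
move=> c u v; apply: talgP => m; rewrite tcompP /=.
have [->|mn] := eqVneq m n; first by rewrite !dirac_eq.
by rewrite !dirac_neq // scaler0 addr0.
Qed.
Lemma talg_sum (f : talg) N : (forall n, (N <= n)%N -> f n = 0) ->
  f = \sum_(n < N) tin (f n).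
Proof.
move=> fN; apply: talgP => m; rewrite tcomp_sum.
have [mN|Nm] := ltnP m N; last first.
  rewrite fN // big1 // => i _ /=; rewrite dirac_neq //.
  by rewrite neq_ltn (leq_trans (ltn_ord i) Nm) orbT.
rewrite (bigD1 (Ordinal mN)) //= dirac_eq big1 ?addr0 // => i im.
by rewrite dirac_neq // eq_sym.
Qed.

Lemma tact_tone n (t : tpow n) : tact t tone = tin t.
Proof.
elim: n t => [|n IH] t.
  apply: talgP => -[|m] /=; first exact: mulr1.
  exact/lin0/(@lact_linr _ _ _ (tpow m.+1)).
elim/tens_ind: t => [x t|u v IHu IHv]; first by rewrite tactS IH tin_tmul.
by rewrite (linD (@tact_linl n.+1 _)) (linD (@tin_lin _)) IHu IHv.
Qed.

Lemma tprod_tin n (t : tpow n) g : tprod (tin t) g = tact t g.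
Proof. by rewrite -tact_tone tprod_tact (@tprodE 1) => [|[]//]; rewrite big_ord1; congr (tact t _); apply: talgP => n'; apply: lact1. Qed.

Fact tprod1l : left_id tone tprod.
Proof. by move=> g; rewrite tprod_tin; apply: talgP => n; apply: lact1. Qed.
Fact tprod1r : right_id tone tprod.
Proof.
move=> f; have [N fN] := tcomp_supp f; rewrite (tprodE _ fN) [RHS](talg_sum fN).
by apply: eq_bigr => i _; rewrite tact_tone.
Qed.
Fact tone_neq0 : tone != 0.
Proof.
apply/eqP => /(congr1 (fun f : talg => f 0%N : R)) /= /eqP.
by rewrite oner_eq0.
Qed.

HB.instance Definition _ := GRing.Zmodule_isNzRing.Build talg
  tprodA tprod1l tprod1r tprodDl tprodDr tone_neq0.
Fact talg_scalerAl c (f g : talg) : c *: (f * g) = (c *: f) * g.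
Proof. exact: tprodZl. Qed.
Fact talg_scalerAr c (f g : talg) : c *: (f * g) = f * (c *: g).
Proof. by rewrite [RHS](linZ (tprod_linr f)). Qed.
HB.instance Definition _ := GRing.Lmodule_isLalgebra.Build k talg talg_scalerAl.
HB.instance Definition _ := GRing.Lalgebra_isAlgebra.Build k talg talg_scalerAr.

Lemma talg_tin0 a (f : talg) : @tin 0 a * f = tlmul a f.
Proof. exact: tprod_tin. Qed.
Lemma talg_tinS n x (t : tpow n) (f : talg) :
  tin (tmul x t : tpow n.+1) * f = tshift x (tin t * f).
Proof. by rewrite /GRing.mul /= !tprod_tin tactS. Qed.

Definition tideal : set talg := ideal_generated (range (@tin 1)).

(* The generated ideal is the sum of the positive tensor powers. *)
Lemma tidealE (f : talg) : tideal f <-> f 0%N = 0.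
Proof.
have f0P : two_sided_ideal [set g : talg | g 0%N = 0].
  have tact0 n (t : tpow n) (g : talg) : (n = 0%N -> g 0%N = 0) -> tact t g 0%N = 0.
    case: n t => [|n] t g0; first by rewrite /= g0 // mulr0.
    elim/tens_ind: t => [x t|u v IHu IHv]; first by rewrite tactS.
    by rewrite (linD (@tact_linl n.+1 _)) tcompD IHu IHv addr0.
  split; first split=> //= [g h g0 h0|g h h0].
  - by rewrite -[LHS]/(g 0%N + h 0%N) g0 h0 addr0.
  - rewrite /GRing.mul /= /tprod tcomp_sum big1 // => i _.
    exact (tact0 i (g i) h (fun _ => h0)).
  - move=> g h /= g0; rewrite /GRing.mul /= /tprod tcomp_sum big1 // => -[[|n] ni] _ /=.
      by rewrite g0 mul0r.
    have n0 : n.+1 = 0%N -> h 0%N = 0 by [].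
    exact (tact0 n.+1 (g n.+1) h n0).
split=> [|f0]; first by move=> If; apply: (If _ f0P) => _ [x _ <-].
move=> K [[K0 KD KM] KR] genK.
pose path (x : M) : tpow 1 := tmul x (1 : regular_bimod R).
have tin1 x : K (tin (path x)) by apply: genK; exists (path x).
have Kt n (t : tpow n.+1) : K (tin t).
  elim/tens_ind: t => [x t|u v Ku Kv]; last by rewrite (linD (@tin_lin n.+1)); apply: KD.
  have -> : tin (tmul x t : tpow n.+1) = tin (path x) * tin t.
    rewrite talg_tinS tin_tmul talg_tin0; congr tshift.
    by apply: talgP => m; rewrite /= lact1.
  exact: KR.
have [N fN] := tcomp_supp f; rewrite (talg_sum fN); elim/big_ind: _ => // -[[|n] ni] _ //=.
by rewrite f0 (lin0 (@tin_lin 0)).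
Qed.

End TensorAlgebra.

Arguments tideal {k R} M.

Section Decomposition.
Variables (k : fieldType) (B : algType k).

(* [B] as the internal direct sum of finitely many nonzero two-sided ideals. *)
Record ideal_decomposition := IdealDecomposition {
  didx :> finType;
  dideal : didx -> set B;
  dideal_ideal : forall i, two_sided_ideal (dideal i);
  dideal_neq0 : forall i, dideal i <> [set 0];
  ddirect : forall b : B, exists! c : didx -> B,
    (forall i, dideal i (c i)) /\ b = \sum_i c i }.

Variable D : ideal_decomposition.

Definition dproj (i : D) (b : B) : B := projT1 (cid (ddirect D b)) i.

Lemma dproj_ideal i b : dideal i (dproj i b).
Proof. by rewrite /dproj; case: (cid _) => c [[cP _] _] /=. Qed.
Lemma dproj_sum b : b = \sum_i dproj i b.
Proof. by rewrite /dproj; case: (cid _) => c [[_ cE] _] /=. Qed.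
Lemma dproj_uniq (c : D -> B) b i :
  (forall i, dideal i (c i)) -> b = \sum_i c i -> dproj i b = c i.
Proof. by rewrite /dproj; case: (cid _) => d [_ dU] /= cP bE; rewrite (dU c). Qed.

Lemma dproj_id i b : dideal i b -> dproj i b = b.
Proof.
move=> ib; rewrite (@dproj_uniq (fun j => if j == i then b else 0)) ?eqxx //.
  by move=> j; case: eqP => [->//|_]; have [[]] := dideal_ideal j.
by rewrite -big_mkcond big_pred1_eq.
Qed.
Lemma dproj_mull i a b : dproj i (a * b) = a * dproj i b.
Proof.
rewrite (@dproj_uniq (fun j => a * dproj j b)) //.
  by move=> j; have [[_ _ jM] _] := dideal_ideal j; apply/jM/dproj_ideal.
by rewrite -mulr_sumr -dproj_sum.
Qed.
Lemma dproj_mulr i a b : dproj i (a * b) = dproj i a * b.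
Proof.
rewrite (@dproj_uniq (fun j => dproj j a * b)) //.
  by move=> j; have [_ jM] := dideal_ideal j; apply/jM/dproj_ideal.
by rewrite -mulr_suml -dproj_sum.
Qed.

Lemma didx_inhabited : inhabited D.
Proof.
apply: contrapT => D0; have /eqP := oner_neq0 B; apply.
by rewrite [LHS]dproj_sum big1 // => i _; case: D0.
Qed.

Definition dpred (i : D) : {pred B} := [pred b | `[< dideal i b >]].

Lemma dpredP i b : (b \in dpred i) <-> dideal i b.
Proof. by split=> /asboolP. Qed.

Fact dpred_closed i : submod_closed (dpred i).
Proof.
have [[i0 iD iM] _] := dideal_ideal i.
split=> [|c x y /dpredP ix /dpredP iy]; apply/dpredP => //.
by apply: iD => //; rewrite -mulr_algl; apply: iM.
Qed.
HB.instance Definition _ i := GRing.isSubmodClosed.Build k B (dpred i) (dpred_closed i).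

Section Component.
Variable i : D.

(* The ideal [A_i] as an algebra; its unit is the component of [1]. *)
Record dcomp : Type := DComp { dval : B; _ : dval \in dpred i }.
HB.instance Definition _ := [isSub for dval].
HB.instance Definition _ := [Choice of dcomp by <:].
HB.instance Definition _ := [SubChoice_isSubLmodule of dcomp by <:].

Lemma dvalP (x : dcomp) : dideal i (dval x).
Proof. exact/dpredP/(valP x). Qed.

Fact dcomp_one_in : dproj i 1 \in dpred i.
Proof. exact/dpredP/dproj_ideal. Qed.
Fact dcomp_mul_in (x y : dcomp) : dval x * dval y \in dpred i.
Proof. by apply/dpredP; have [[_ _ iM] _] := dideal_ideal i; apply/iM/dvalP. Qed.
Definition dcomp_one : dcomp := DComp dcomp_one_in.
Definition dcomp_mul (x y : dcomp) : dcomp := DComp (dcomp_mul_in x y).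

Fact dcomp_mulA : associative dcomp_mul.
Proof. by move=> x y z; apply: val_inj; apply: mulrA. Qed.
Fact dcomp_mul1 : left_id dcomp_one dcomp_mul.
Proof. by move=> x; apply: val_inj; rewrite /= -dproj_mulr mul1r dproj_id //; apply: dvalP. Qed.
Fact dcomp_1mul : right_id dcomp_one dcomp_mul.
Proof. by move=> x; apply: val_inj; rewrite /= -dproj_mull mulr1 dproj_id //; apply: dvalP. Qed.
Fact dcomp_mulDl : left_distributive dcomp_mul +%R.
Proof. by move=> x y z; apply: val_inj; apply: mulrDl. Qed.
Fact dcomp_mulDr : right_distributive dcomp_mul +%R.
Proof. by move=> x y z; apply: val_inj; apply: mulrDr. Qed.
Fact dcomp_1neq0 : dcomp_one != 0.
Proof.
apply/eqP => /(congr1 dval) /= e0; case: (dideal_neq0 (i := i)).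
have [[i0 _ _] _] := dideal_ideal i; apply/seteqP; split=> [b ib|_ ->//] /=.
by rewrite -(dproj_id ib) -[b]mulr1 dproj_mull e0 mulr0.
Qed.
HB.instance Definition _ := GRing.Zmodule_isNzRing.Build dcomp
  dcomp_mulA dcomp_mul1 dcomp_1mul dcomp_mulDl dcomp_mulDr dcomp_1neq0.
Fact dcomp_scalerAl c (x y : dcomp) : c *: (x * y) = (c *: x) * y.
Proof. by apply: val_inj; apply: scalerAl. Qed.
Fact dcomp_scalerAr c (x y : dcomp) : c *: (x * y) = x * (c *: y).
Proof. by apply: val_inj; apply: scalerAr. Qed.
HB.instance Definition _ := GRing.Lmodule_isLalgebra.Build k dcomp dcomp_scalerAl.
HB.instance Definition _ := GRing.Lalgebra_isAlgebra.Build k dcomp dcomp_scalerAr.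

End Component.
End Decomposition.

Section Radical.
Variables (k : fieldType) (A : algType k).

Definition rad_pred : {pred A} := [pred a | `[< jacobson_radical a >]].

Lemma rad_predP a : (a \in rad_pred) <-> jacobson_radical a.
Proof. by split=> /asboolP. Qed.

Fact rad_closed : submod_closed rad_pred.
Proof.
have [[J0 JD JM] _] := jacobson_ideal A.
split=> [|c x y /rad_predP Jx /rad_predP Jy]; apply/rad_predP => //.
by apply: JD => //; rewrite -mulr_algl; apply: JM.
Qed.
HB.instance Definition _ := GRing.isSubmodClosed.Build k A rad_pred rad_closed.

Fact rad_proper : proper_two_sided rad_pred.
Proof.
have [[J0 JD JM] JR] := jacobson_ideal A.
split=> [a x /rad_predP Jx|a x /rad_predP Jx|]; first by apply/rad_predP; apply: JM.
  by apply/rad_predP; apply: JR.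
by apply/negP => /rad_predP; apply: jacobson_proper.
Qed.

Definition radquo : algType k := qalg rad_proper.
Definition radpi : A -> radquo := qalg_pi rad_proper.
HB.instance Definition _ := GRing.LRMorphism.on radpi.

Lemma radpiP a b : radpi a = radpi b <-> jacobson_radical (a - b).
Proof. by rewrite -rad_predP; apply: qalg_piP. Qed.
Lemma radpi_surj b : exists a, radpi a = b.
Proof. by exists (qmod_repr b); apply: qmod_reprK. Qed.

Record rad : Type := Rad { rval : A; _ : rval \in rad_pred }.
HB.instance Definition _ := [isSub for rval].
HB.instance Definition _ := [Choice of rad by <:].
HB.instance Definition _ := [SubChoice_isSubLmodule of rad by <:].

(* [r^2], as a submodule of [r]. *)
Definition rad2 : {pred rad} :=
  lspan_pred [set u | exists x y : rad, rval u = rval x * rval y].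
HB.instance Definition _ := GRing.SubmodClosed.on rad2.

Fact rad_lmul_in a (x : rad) : a * rval x \in rad_pred.
Proof. by have [rM _ _] := rad_proper; apply/rM/(valP x). Qed.
Fact rad_rmul_in (x : rad) a : rval x * a \in rad_pred.
Proof. by have [_ rM _] := rad_proper; apply/rM/(valP x). Qed.
Definition rad_lmul a (x : rad) : rad := Rad (rad_lmul_in a x).
Definition rad_rmul (x : rad) a : rad := Rad (rad_rmul_in x a).

Fact rad_lmul_linr a : linear (rad_lmul a).
Proof. by move=> c x y; apply: val_inj; apply: mulr_linr. Qed.
Fact rad_lmul_linl x : linear (rad_lmul^~ x).
Proof. by move=> c a b; apply: val_inj; apply: mulr_linl. Qed.
Fact rad_rmul_linr x : linear (rad_rmul x).
Proof. by move=> c a b; apply: val_inj; apply: mulr_linr. Qed.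
Fact rad_rmul_linl a : linear (rad_rmul^~ a).
Proof. by move=> c x y; apply: val_inj; apply: mulr_linl. Qed.

Fact rad2_ind (f : rad -> rad) : linear f ->
  (forall u x y : rad, rval u = rval x * rval y -> f u \in rad2) ->
  forall u, u \in rad2 -> f u \in rad2.
Proof.
move=> fl fE u; pose U : {pred rad} := fun v => f v \in rad2.
apply: (@lspan_ind _ _ _ U).
  split=> [|c x y fx fy]; first by rewrite -[_ \in U]/(f 0 \in rad2) (lin0 fl) rpred0.
  rewrite -[_ \in U]/(f (c *: x + y) \in rad2) (linD fl) (linZ fl).
  by apply: rpredD => //; apply: rpredZ.
by move=> v [x [y vE]]; apply: fE vE.
Qed.
Fact rad2_lmul a u : u \in rad2 -> rad_lmul a u \in rad2.
Proof.
apply: rad2_ind; first exact: rad_lmul_linr.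
move=> v x y vE; apply: mem_lspan; exists (rad_lmul a x), y.
by rewrite /= vE mulrA.
Qed.
Fact rad2_rmul a u : u \in rad2 -> rad_rmul u a \in rad2.
Proof.
apply: rad2_ind (rad_rmul_linl a) _ u => v x y vE.
by apply: mem_lspan; exists x, (rad_rmul y a); rewrite /= vE mulrA.
Qed.

Definition rlayer : Type := qmod rad2.
HB.instance Definition _ := GRing.Lmodule.on rlayer.
Definition rlayer_pi : rad -> rlayer := qmod_pi rad2.

Definition rlayer_lact (b : radquo) (q : rlayer) : rlayer :=
  rlayer_pi (rad_lmul (qmod_repr b) (qmod_repr q)).
Definition rlayer_ract (q : rlayer) (b : radquo) : rlayer :=
  rlayer_pi (rad_rmul (qmod_repr q) (qmod_repr b)).

Lemma rlayer_lactE a x :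
  rlayer_lact (radpi a) (rlayer_pi x) = rlayer_pi (rad_lmul a x).
Proof.
apply/qmod_piP; set a' := qmod_repr _; set x' := qmod_repr _.
have -> : rad_lmul a' x' - rad_lmul a x = rad_lmul (a' - a) x' + rad_lmul a (x' - x).
  by rewrite (linB (rad_lmul_linl _)) (linB (rad_lmul_linr _)) addrA subrK.
apply: rpredD; last by apply/rad2_lmul/qmod_piP; rewrite qmod_reprK.
have aa' : a' - a \in rad_pred by apply/qmod_piP; rewrite qmod_reprK.
by apply: mem_lspan; exists (Rad aa'), x'.
Qed.
Lemma rlayer_ractE a x :
  rlayer_ract (rlayer_pi x) (radpi a) = rlayer_pi (rad_rmul x a).
Proof.
apply/qmod_piP; set a' := qmod_repr (radpi a); set x' := qmod_repr _.
have -> : rad_rmul x' a' - rad_rmul x a = rad_rmul x' (a' - a) + rad_rmul (x' - x) a.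
  by rewrite (linB (rad_rmul_linl _)) (linB (rad_rmul_linr _)) addrA subrK.
apply: rpredD; last by apply/rad2_rmul/qmod_piP; rewrite qmod_reprK.
have aa' : a' - a \in rad_pred by apply/qmod_piP; rewrite qmod_reprK.
by apply: mem_lspan; exists x', (Rad aa').
Qed.

Fact radquo_ind (P : radquo -> Prop) : (forall a, P (radpi a)) -> forall b, P b.
Proof. exact: qalg_ind. Qed.
Fact rlayer_ind (P : rlayer -> Prop) : (forall x, P (rlayer_pi x)) -> forall q, P q.
Proof. by move=> PA q; rewrite -[q]qmod_reprK; apply: PA. Qed.
Fact rlayer_pi_lin : linear rlayer_pi.
Proof. by move=> c x y; rewrite /rlayer_pi linearP. Qed.

(* [r/r^2] as an [A/r]-[A/r]-bimodule. *)
Definition rlayer_bimod : bimod radquo radquo.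
Proof.
refine (@Bimod k radquo radquo rlayer rlayer_lact rlayer_ract _ _ _ _ _ _ _ _ _).
- elim/rlayer_ind=> x c; elim/radquo_ind=> a; elim/radquo_ind=> b.
  by rewrite -linearP !rlayer_lactE rad_lmul_linl rlayer_pi_lin.
- elim/radquo_ind=> a c; elim/rlayer_ind=> x; elim/rlayer_ind=> y.
  by rewrite -rlayer_pi_lin !rlayer_lactE rad_lmul_linr rlayer_pi_lin.
- elim/rlayer_ind=> x; rewrite -(rmorph1 radpi) rlayer_lactE; congr rlayer_pi.
  by apply: val_inj; apply: mul1r.
- elim/radquo_ind=> a; elim/radquo_ind=> b; elim/rlayer_ind=> x.
  rewrite -rmorphM !rlayer_lactE; congr rlayer_pi.
  by apply: val_inj; rewrite /= mulrA.
- elim/radquo_ind=> a c; elim/rlayer_ind=> x; elim/rlayer_ind=> y.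
  by rewrite -rlayer_pi_lin !rlayer_ractE rad_rmul_linl rlayer_pi_lin.
- elim/rlayer_ind=> x c; elim/radquo_ind=> a; elim/radquo_ind=> b.
  by rewrite -linearP !rlayer_ractE rad_rmul_linr rlayer_pi_lin.
- elim/rlayer_ind=> x; rewrite -(rmorph1 radpi) rlayer_ractE; congr rlayer_pi.
  by apply: val_inj; apply: mulr1.
- elim/rlayer_ind=> x; elim/radquo_ind=> a; elim/radquo_ind=> b.
  rewrite -rmorphM !rlayer_ractE; congr rlayer_pi.
  by apply: val_inj; rewrite /= mulrA.
- elim/radquo_ind=> a; elim/rlayer_ind=> x; elim/radquo_ind=> b.
  rewrite !(rlayer_lactE, rlayer_ractE); congr rlayer_pi.
  by apply: val_inj; rewrite /= mulrA.
Defined.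

Definition splits_over_radical : Prop :=
  exists rho : {lrmorphism radquo -> A}, forall b, radpi (rho b) = b.

End Radical.

Section Generators.
Variables (k : fieldType) (R S : algType k) (V : bimod R S) (X : set R) (Y : set S).

(* [X.V.Y] *)
Definition block : set V :=
  lspan [set v | exists a u b, [/\ X a, Y b & v = ract (lact a u) b]].

Definition block_generated_by n (g : 'I_n -> V) : Prop :=
  (forall l, block (g l)) /\
  block = lspan [set v | exists l a b, [/\ X a, Y b & v = ract (lact a (g l)) b]].

(* [0] if there is no finite generating family. *)
Definition block_rank : nat :=
  if pselect (exists n, `[< exists g : 'I_n -> V, block_generated_by g >]) is left ex
  then ex_minn ex else 0%N.

End Generators.

(* Number of arrows from [i] to [j] in the natural quiver. *)
Definition natural_quiver (k : fieldType) (A : algType k)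
    (D : ideal_decomposition (radquo A)) (i j : D) : nat :=
  block_rank (rlayer_bimod A) (dideal j) (dideal i).

Section GeneralizedPathAlgebra.
Variables (k : fieldType) (I : finType) (I0 : inhabited I) (A : I -> algType k).
Variable t : I -> I -> nat.

Definition arrow : Type := {ij : I * I & 'I_(t ij.1 ij.2)}.
Definition arrow_src (w : arrow) : I := (tag w).1.
Definition arrow_tgt (w : arrow) : I := (tag w).2.

(* The free [A_j]-[A_i]-bimodule [A_j (x)_k A_i] on one arrow from [i] to [j]. *)
Definition arrow_bimod (w : arrow) : bimod (A (arrow_tgt w)) (A (arrow_src w)) :=
  tens_bimod (left_regular (A (arrow_tgt w))) (right_regular (A (arrow_src w))).

(* As there are finitely many arrows, the direct sum is a product. *)
Definition gpa_mod : Type := dprod arrow_bimod.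
HB.instance Definition _ := GRing.Lmodule.on gpa_mod.

(* An arrow [w : i -> j] contributes [A_j w A_i]: [A_0] acts on the left through
   the target of [w] and on the right through its source. *)
Definition gpa_lact (a : aprod A I0) (m : gpa_mod) : gpa_mod :=
  fun w => lact (a (arrow_tgt w)) (m w).
Definition gpa_ract (m : gpa_mod) (a : aprod A I0) : gpa_mod :=
  fun w => ract (m w) (a (arrow_src w)).

Definition gpa_bimod : bimod (aprod A I0) (aprod A I0).
Proof.
refine (@Bimod k _ _ gpa_mod gpa_lact gpa_ract _ _ _ _ _ _ _ _ _);
  repeat (move=> ?); apply: functional_extensionality_dep => w.
- exact: lact_linl.
- exact: lact_linr.
- exact: lact1.
- exact: lactM.
- exact: ract_linl.
- exact: ract_linr.
- exact: ract1.
- exact: ractM.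
- exact: lractA.
Defined.

Definition gpa : algType k := talg gpa_bimod.

(* The ideal generated by the paths of length [1]. *)
Definition gpa_ideal : set gpa := tideal gpa_bimod.

End GeneralizedPathAlgebra.

Arguments gpa_ideal {k I} I0 A t.

Section Gabriel.
Variables (k : fieldType) (A : algType k) (D : ideal_decomposition (radquo A)).

Definition associated_gpa : algType k :=
  gpa (didx_inhabited D) (fun i : D => dcomp i : algType k) (@natural_quiver _ _ D).
Definition associated_ideal : set associated_gpa :=
  gpa_ideal (didx_inhabited D) (fun i : D => dcomp i : algType k)
    (@natural_quiver _ _ D).

Definition gabriel_type : Prop :=
  exists pi : {lrmorphism associated_gpa -> A},
    (forall a, exists z, pi z = a) /\
    (forall z, pi z = 0 -> associated_ideal z).

End Gabriel.

(* Main.v *)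
Require Import Defs.
From HB Require Import structures.
From mathcomp Require Import all_boot all_algebra.
From mathcomp Require Import boolp classical_sets.

(* Let [rho] split [A -> A/r].  Together with representatives in [r] of bimodule
   generators of the blocks [A_j (r/r^2) A_i] it induces [pi] on the tensor algebra.
   The image of [pi] is a subalgebra that covers [A] modulo [r] and [r] modulo [r^2],
   hence all of [A], as [r] is nilpotent; modulo [r] the map [pi] is the projection
   on degree [0], so its kernel lies in [J].  The generating families are finite
   because [r/r^2] is a module over the semisimple ring [A/r] with the descending
   chain condition.

   Conversely, if [ker pi] lies in [J], the projection on degree [0] factors through
   a surjection [A -> A/r].  It kills [r], so it induces a surjective, hence
   injective, endomorphism of the semisimple algebra [A/r], and thus it is inverse
   to the degree [0] part of [pi] modulo [r]. *)

Set Implicit Arguments.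
Unset Strict Implicit.
Unset Printing Implicit Defensive.

Import GRing.Theory.
Local Open Scope ring_scope.
Local Open Scope classical_set_scope.

Lemma lspan_map (k : fieldType) (U V : lmodType k) (f : U -> V) (E : set U) (F : set V) :
  linear f -> (forall x, E x -> lspan F (f x)) -> forall x, lspan E x -> lspan F (f x).
Proof.
move=> fl fE x /lspan_predP Ex; apply/lspan_predP.
pose W : {pred U} := fun x => f x \in lspan_pred F.
apply: (lspan_ind (U := W)) Ex => [|y /fE/lspan_predP//].
split=> [|c u v Wu Wv]; rewrite /W unfold_in; first by rewrite (lin0 fl) rpred0.
by rewrite fl rpredD // rpredZ.
Qed.

(** * The universal property of the tensor algebra *)

Section TensorAlgebraLift.
Variables (k : fieldType) (R A : algType k) (M : bimod R R).
Variables (rho : {lrmorphism R -> A}) (phi : {linear M -> A}).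
Hypothesis phi_lact : forall a x, phi (lact a x) = rho a * phi x.
Hypothesis phi_ract : forall x a, phi (ract x a) = phi x * rho a.

Fixpoint tpow_lift (n : nat) : tpow M n -> A :=
  match n with
  | 0 => fun a => rho a
  | n'.+1 => fun t =>
      tlift (fun (x : M) (t' : tpow M n') => phi x * tpow_lift t')
        (t : tens M (tpow M n'))
  end.

Fact tpow_lift_balanced_of n : linear (@tpow_lift n) ->
  (forall a (t : tpow M n), tpow_lift (lact a t) = rho a * tpow_lift t) ->
  balanced (fun (x : M) (t : tpow M n) => phi x * tpow_lift t).
Proof.
move=> lin lactE; split=> [t c x y|x c t u|x s t].
- by rewrite linearP mulrDl scalerAl.
- by rewrite lin mulrDr scalerAr.
- by rewrite phi_ract lactE mulrA.
Qed.

(** The two claims need one common induction: balancedness in degree [n] uses both, and [tlift] is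
    meaningful in degree [n.+1] only for a balanced map. *)
Fact tpow_lift_linear_lact n : linear (@tpow_lift n) /\
  (forall a (t : tpow M n), tpow_lift (lact a t) = rho a * tpow_lift t).
Proof.
elim: n => [|n [IHl IHa]]; first by split; [exact: linearP | exact: rmorphM].
have bal := tpow_lift_balanced_of IHl IHa.
have lin : linear (@tpow_lift n.+1) := tlift_linear bal.
split=> // a; elim/tens_ind=> [x t|u v IHu IHv].
  by rewrite [lact _ _]tens_lactE /= !(tliftE bal) phi_lact mulrA.
by rewrite (linD (lact_linr _)) !(linD lin) IHu IHv mulrDr.
Qed.

Lemma tpow_lift_linear n : linear (@tpow_lift n).
Proof. by have [] := tpow_lift_linear_lact n. Qed.

Lemma tpow_lift_tmul n x (t : tpow M n) :
  @tpow_lift n.+1 (tmul x t) = phi x * tpow_lift t.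
Proof.
by have [lin lactE] := tpow_lift_linear_lact n;
  exact: (tliftE (tpow_lift_balanced_of lin lactE)).
Qed.

Definition talg_lift (f : talg M) : A := \sum_(n < tbound f) tpow_lift (f n).

(** [tbound f] is an arbitrary choice; terms beyond the support vanish, so two bounds agree through
    their maximum. *)
Lemma talg_liftE N (f : talg M) : (forall n, (N <= n)%N -> f n = 0) ->
  talg_lift f = \sum_(n < N) tpow_lift (f n).
Proof.
have widen N1 N2 : (forall n, (N1 <= n)%N -> f n = 0) -> (N1 <= N2)%N ->
    \sum_(n < N1) tpow_lift (f n) = \sum_(n < N2) tpow_lift (f n).
  move=> f0 N12; rewrite (big_ord_widen N2 (fun n => tpow_lift (f n))) // big_mkcond /=.
  apply: eq_bigr => i _; case: ltnP => // /f0 ->.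
  by rewrite (lin0 (@tpow_lift_linear _)).
move=> fN; rewrite /talg_lift /tbound; case: (cid _) => /= B fB.
by rewrite (widen _ (maxn B N)) ?leq_maxl // -(widen N) ?leq_maxr.
Qed.

Fact talg_lift_linear : linear talg_lift.
Proof.
move=> c f g; have [N fN] := tcomp_supp f; have [N' gN] := tcomp_supp g.
have fM n : (maxn N N' <= n)%N -> f n = 0 by rewrite geq_max => /andP[/fN].
have gM n : (maxn N N' <= n)%N -> g n = 0 by rewrite geq_max => /andP[_ /gN].
rewrite (talg_liftE fM) (talg_liftE gM) (@talg_liftE (maxn N N')) => [|n Mn].
  rewrite scaler_sumr -big_split; apply: eq_bigr => i _.
  by rewrite tcompP tpow_lift_linear.
by rewrite tcompP fM // gM // scaler0 addr0.
Qed.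

Lemma talg_lift_tin n (t : tpow M n) : talg_lift (tin t) = tpow_lift t.
Proof.
rewrite (@talg_liftE n.+1) => [|m nm]; last by rewrite /= dirac_neq // gtn_eqF.
rewrite big_ord_recr /= dirac_eq big1 ?add0r // => i _ /=.
by rewrite dirac_neq ?(lin0 (@tpow_lift_linear _)) // ltn_eqF.
Qed.

Fact talg_lift_tlmul a f : talg_lift (tlmul a f) = rho a * talg_lift f.
Proof.
have [N fN] := tcomp_supp f.
rewrite (talg_liftE fN) (@talg_liftE N) => [|n /fN /= ->]; last first.
  exact/lin0/lact_linr.
rewrite mulr_sumr; apply: eq_bigr => i _.
by have [_ ->] := tpow_lift_linear_lact i.
Qed.

Fact talg_lift_tshift x f : talg_lift (tshift x f) = phi x * talg_lift f.
Proof.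
have [N fN] := tcomp_supp f.
rewrite (talg_liftE fN) (@talg_liftE N.+1) => [|[//|n] /fN /= ->]; last first.
  exact/lin0/tmul_linr.
rewrite big_ord_recl (lin0 (@tpow_lift_linear _)) add0r mulr_sumr.
by apply: eq_bigr => i _; rewrite -tpow_lift_tmul.
Qed.

(** The product of [talg M] is a sum of values of [tact], so this gives multiplicativity. Pure
    tensors reduce it to one factor [x] at a time. *)
Fact talg_lift_tact n (t : tpow M n) f :
  talg_lift (tact t f) = tpow_lift t * talg_lift f.
Proof.
elim: n t => [|n IH] t; first exact: talg_lift_tlmul.
elim/tens_ind: t => [x t|u v IHu IHv].
  by rewrite tactS talg_lift_tshift tpow_lift_tmul IH mulrA.
rewrite (linD (@tact_linl _ _ _ n.+1 _)) (linD talg_lift_linear) IHu IHv.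
by rewrite (linD (@tpow_lift_linear _)) mulrDl.
Qed.

Fact talg_lift_monoid : monoid_morphism talg_lift.
Proof.
split=> [|f g]; first by rewrite talg_lift_tin /= rmorph1.
rewrite [f * g]/(tprod f g) /tprod (lin_sum talg_lift_linear) mulr_suml.
by apply: eq_bigr => i _; rewrite talg_lift_tact.
Qed.

Definition talg_lift_lrmorphism : {lrmorphism talg M -> A} :=
  HB.pack talg_lift (GRing.isLinear.Build k (talg M) A *:%R talg_lift talg_lift_linear)
    (GRing.isMonoidMorphism.Build (talg M) A talg_lift talg_lift_monoid).

End TensorAlgebraLift.

(** * The radical of a left Artinian algebra *)

Section LeftArtinian.
Variables (k : fieldType) (A : algType k).
Implicit Types (X Y L : set A) (s : seq A).
Local Notation J := (@jacobson_radical k A).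

Lemma left_idealB X x y : left_ideal X -> X x -> X y -> X (x - y).
Proof. by move=> lX Xx Xy; have [_ XD _] := lX; apply: XD => //; apply: left_idealN. Qed.

(** The left ideal [X + L] strictly contains [L], hence contains [1]. *)
Lemma maximal_left_ideal_comaximal L X : maximal_left_ideal L -> left_ideal X ->
  ~ X `<=` L -> exists2 x, X x & L (1 - x).
Proof.
move=> [lL LT Lmax] lX XL; have [[L0 LD LM] [X0 XD XM]] := (lL, lX).
pose S : set A := [set z | exists x l, [/\ X x, L l & z = x + l]].
have lS : left_ideal S.
  split=> [|_ _ [x [l [Xx Ll ->]]] [y [m [Xy Lm ->]]]|a _ [x [l [Xx Ll ->]]]].
  - by exists 0, 0; rewrite addr0.
  - by exists (x + y), (l + m); rewrite addrACA; split; [exact: XD|exact: LD|].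
  - by exists (a * x), (a * l); rewrite mulrDr; split; [exact: XM|exact: LM|].
have [|SL|ST] := Lmax S lS.
- by move=> l Ll; exists 0, l; rewrite add0r.
- by case: XL => x Xx; rewrite -SL; exists x, 0; rewrite addr0.
- have [x [l [Xx Ll E]]] : S 1 by rewrite ST.
  by exists x => //; rewrite E addrAC subrr add0r.
Qed.

Hypothesis artA : left_artinian A.

(** Otherwise every left ideal with [P] properly contains another one, and iterating a choice of
    these gives a chain that never stabilizes. *)
Lemma left_artinian_min (P : set A -> Prop) X0 : left_ideal X0 -> P X0 ->
  exists X, [/\ left_ideal X, P X &
    forall Y, left_ideal Y -> P Y -> Y `<=` X -> Y = X].
Proof.
move=> lX0 PX0; apply: contrapT => nomin.
pose T := {X : set A | left_ideal X /\ P X}.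
have step (X : T) : exists Y : T, sval Y `<=` sval X /\ sval Y <> sval X.
  apply: contrapT => noY; apply: nomin; have [lX PX] := svalP X.
  exists (sval X); split=> // Y lY PY YX; apply: contrapT => YneX.
  by apply: noY; exists (exist _ Y (conj lY PY)).
have [f fP] := choice step.
pose X n : T := iter n f (exist _ X0 (conj lX0 PX0)).
have [|n|N XN] := @artA (fun n => sval (X n)).
- by move=> n; have [] := svalP (X n).
- by have [] := fP (X n).
- by have [_] := fP (X N); apply; apply: (XN N.+1).
Qed.

(* Modulo [r] each [A e] is a quotient of [A/L], so [A/r] is a sum of simple modules. *)
Lemma jacobson_simple_decomposition : exists2 s, J (1 - \sum_(e <- s) e) &
  forall e, e \in s -> exists2 L, maximal_left_ideal L & forall l, L l -> J (l * e).
Proof.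
(* This is the goal with [X] in place of [J]. It holds for [setT] with no summand, and a minimal
   such [X] turns out to lie in [J]. *)
pose P X := exists2 s, X (1 - \sum_(e <- s) e) &
  forall e, e \in s -> exists2 L, maximal_left_ideal L & forall l, L l -> X (l * e).
have [||X [lX [s Xs sP] Xmin]] := @left_artinian_min P setT.
- by split.
- by exists [::].
have XJ : X `<=` J.
  move=> x Xx L mL; apply: contrapT => nLx.
  have [[X0 XD XM] [lL _ _]] := (lX, mL); have [L0 LD LM] := lL.
  have [|y Xy Ly] := maximal_left_ideal_comaximal mL lX; first by move=> /(_ x Xx).
  have lXL : left_ideal (X `&` L).
    split=> [|u v [Xu Lu] [Xv Lv]|a u [Xu Lu]]; split; by auto.
  have XLE := Xmin _ lXL _ (@subIsetl _ X L); case: nLx.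
  suff : (X `&` L) x by case.
  (* As [y] is in [X] and [1 - y] in [L], the new defect [(1 - u) * (1 - y)] lies in both. So the
     intersection of [X] and [L] satisfies [P], and minimality puts [X] inside [L]. *)
  rewrite XLE //; exists (y :: [seq e * (1 - y) | e <- s]).
    rewrite big_cons big_map -mulr_suml.
    set u := \sum_(e <- s) e in Xs *.
    have -> : 1 - (y + u * (1 - y)) = (1 - u) * (1 - y).
      by rewrite mulrBl mul1r opprD addrA.
    split; last exact: LM.
    by rewrite mulrBr mulr1; apply: left_idealB => //; apply: XM.
  move=> e; rewrite inE => /predU1P[->|/mapP[d ds ->]].
    exists L => // l Ll; split; first exact: XM.
    have -> : l * y = l - l * (1 - y) by rewrite mulrBr mulr1 subKr.
    by apply: left_idealB => //; apply: LM.
  have [K mK KX] := sP d ds; exists K => // l Kl; rewrite mulrA; split.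
    by rewrite mulrBr mulr1; apply: left_idealB; [|exact: KX|exact: XM].
  exact: LM.
exists s => [|e es]; first exact: XJ.
by have [L mL LX] := sP e es; exists L => // l /LX /XJ.
Qed.

(** * Finite generation of semisimple layers *)

Definition left_gen Y s : set A := [set x | forall K, left_ideal K ->
  Y `<=` K -> (forall w, w \in s -> K w) -> K x].

Lemma left_gen_ideal Y s : left_ideal (left_gen Y s).
Proof.
split=> [K [K0 _ _]|x y gx gy K lK YK sK|a x gx K lK YK sK] //.
  by have [_ KD _] := lK; apply: KD; [exact: gx | exact: gy].
by have [_ _ KM] := lK; apply: KM; exact: gx.
Qed.

Lemma left_gen_base Y s : Y `<=` left_gen Y s.
Proof. by move=> y Yy K _ YK _; apply: YK. Qed.

Lemma left_gen_mem Y s w : w \in s -> left_gen Y s w.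
Proof. by move=> ws K _ _; apply. Qed.

Lemma left_gen_sub Y s t : {subset s <= t} -> left_gen Y s `<=` left_gen Y t.
Proof. by move=> st x gx K lK YK tK; apply: gx => // w /st/tK. Qed.

(** The elements admitting such an [a] form a left ideal that contains [Y], [s] and [w]. *)
Lemma left_gen_rcons Y s w x : left_gen Y (rcons s w) x ->
  exists a, left_gen Y s (x - a * w).
Proof.
move=> gx; have [g0 gD gM] := left_gen_ideal Y s.
apply: (gx [set x | exists a, left_gen Y s (x - a * w)]).
- split=> [|y z [a ya] [b zb]|c y [a ya]] /=.
  + by exists 0; rewrite mul0r subr0.
  + by exists (a + b); rewrite mulrDl opprD addrACA; apply: gD.
  + by exists (c * a); rewrite -mulrA -mulrBr; apply: gM.
- by move=> y Yy; exists 0; rewrite mul0r subr0; apply: left_gen_base.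
- move=> v; rewrite mem_rcons inE => /predU1P[->|vs].
    by exists 1; rewrite mul1r subrr.
  by exists 0; rewrite mul0r subr0; apply: left_gen_mem.
Qed.

(* [X / Y] is a module over the semisimple ring [A / r], hence a sum of simple
   modules [A w]; an infinite family of them, each outside the sum of its
   predecessors, would be independent, and its tails would contradict the
   descending chain condition. *)
Lemma semisimple_layer_fin_gen X Y : left_ideal X -> left_ideal Y -> Y `<=` X ->
  (forall z x, J z -> X x -> Y (z * x)) ->
  exists2 s, (forall w, w \in s -> X w) & X `<=` left_gen Y s.
Proof.
move=> lX lY YX JXY; apply: contrapT => nofg.
have [[X0 XD XM] [Y0 YD YM]] := (lX, lY).
(* Modulo [Y], the module [A w] is zero or simple: each nonzero multiple of [w] generates it. *)
pose simple_mod w := forall a, Y (a * w) \/ exists b, Y (w - b * a * w).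
(* The premise on [s] sits under the existential so that [choice] gives a function on all lists;
   lists that leave [X] get the default [0]. *)
have step s : exists w, (forall v, v \in s -> X v) ->
    [/\ X w, simple_mod w & ~ left_gen Y s w].
  have [sX|nsX] := pselect (forall v, v \in s -> X v); last by exists 0.
  have [x [Xx nx]] : exists x, X x /\ ~ left_gen Y s x.
    apply: contrapT => /forallNP nox; apply: nofg; exists s => // x Xx.
    by have /not_andP[//|/contrapT] := nox x.
  (* Modulo [Y], [x] is the sum of the [e * x] for [e] in [t], so one of these escapes
     [left_gen Y s]. *)
  have [t Jt tP] := jacobson_simple_decomposition.
  have [e et ne] : exists2 e, e \in t & ~ left_gen Y s (e * x).
    apply: contrapT => noe; apply: nx; have [g0 gD gM] := left_gen_ideal Y s.
    rewrite -[x]mul1r -[1](subrK (\sum_(e <- t) e)) mulrDl; apply: (gD).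
      by apply: left_gen_base; apply: JXY.
    rewrite mulr_suml big_seq; apply: big_ind => [//||e et]; first exact: gD.
    by apply: contrapT => ne; apply: noe; exists e.
  exists (e * x) => _; split=> //; first exact: XM.
  move=> a; have [L mL Le] := tP e et; have [[L0 LD LM] _ _] := mL.
  have [La|nLa] := pselect (L a).
    by left; rewrite mulrA; apply: JXY => //; apply: Le.
  (* [L] is maximal and misses [a], so some [1 - b * a] lies in [L], and [L] sends [e * x] into
     [Y]. *)
  right; have [||_ [b ->] Lb] :=
    @maximal_left_ideal_comaximal L [set y | exists b, y = b * a] mL.
  - split=> [|_ _ [b ->] [c ->]|c _ [b ->]]; first by exists 0; rewrite mul0r.
      by exists (b + c); rewrite mulrDl.
    by exists (c * b); rewrite mulrA.
  - by move=> /(_ a) La; apply/nLa/La; exists 1; rewrite mul1r.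
  - by exists b; rewrite -{1}[e * x]mul1r -mulrBl mulrA; apply: JXY => //; apply: Le.
have [f fP] := choice step.
pose S n : seq A := iter n (fun s => f s :: s) [::].
pose w n := f (S n).
have SX n v : v \in S n -> X v.
  elim: n v => //= n IH v; rewrite inE => /predU1P[->|/IH//].
  by have [] := fP _ IH.
have wP n : [/\ X (w n), simple_mod (w n) & ~ left_gen Y (S n) (w n)].
  exact/fP/SX.
have wS m n : (m < n)%N -> w m \in S n.
  elim: n => // n IH; rewrite ltnS leq_eqVlt => /predU1P[->|/IH mn] /=.
    exact: mem_head.
  by rewrite inE mn orbT.
pose G n m := left_gen Y [seq w j | j <- iota n m].
have Gle n m m' : (m <= m')%N -> G n m `<=` G n m'.
  move=> mm'; apply: left_gen_sub => _ /mapP[j jm ->]; apply: map_f.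
  by move: jm; rewrite !mem_iota => /andP[-> /leq_trans->] //; rewrite leq_add2l.
(* Remove the last generator [v], used with coefficient [a]. Either [a * v] is in [Y] and induction
   applies, or [v] is a multiple of [a * v] modulo [Y] and would be generated by its
   predecessors. *)
have indep n m : ~ G n.+1 m (w n).
  elim: m => [|m IH].
    move=> g; have [_ _] := wP n; apply.
    by apply: left_gen_sub g.
  rewrite /G -(addn1 m) iotaD map_cat cats1 => /left_gen_rcons[a].
  rewrite -/(w _) -/(G n.+1 m) => g.
  have [g0 gD gM] := left_gen_ideal Y (S (n.+1 + m)%N).
  have [_ simp ng] := wP (n.+1 + m)%N; have [Ya|[b Yb]] := simp a.
    apply: IH; rewrite -[w n](subrK (a * w (n.+1 + m)%N)).
    have [_ GD _] := left_gen_ideal Y [seq w j | j <- iota n.+1 m].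
    by apply: GD => //; apply: left_gen_base.
  apply: ng; rewrite -[w _](subrK (b * a * w (n.+1 + m)%N)); apply: gD.
    exact: left_gen_base.
  rewrite -mulrA; apply: gM.
  have -> : a * w (n.+1 + m)%N = w n - (w n - a * w (n.+1 + m)%N) by rewrite subKr.
  apply: (left_idealB (left_gen_ideal Y _)).
    by apply: left_gen_mem; apply: wS; rewrite addSn ltnS leq_addr.
  apply: left_gen_sub g => _ /mapP[j jm ->]; apply: wS.
  by move: jm; rewrite mem_iota => /andP[].
(* The tails of the family; independence keeps [w N] out of [W N.+1]. *)
pose W n : set A := [set x | exists m, G n m x].
have [n|n x [m gx]|N WN] := artA (X := W).
- split=> [|x y [m gx] [m' gy]|a x [m gx]].
  + by exists 0%N; have [] := left_gen_ideal Y [seq w j | j <- iota n 0].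
  + exists (maxn m m'); have [_ gD _] := left_gen_ideal Y [seq w j | j <- iota n (maxn m m')].
    by apply: gD; [apply: Gle gx; rewrite leq_maxl | apply: Gle gy; rewrite leq_maxr].
  + by exists m; have [_ _] := left_gen_ideal Y [seq w j | j <- iota n m]; apply.
- by exists m.+1; apply: left_gen_sub gx => v /= vm; rewrite inE vm orbT.
- have : W N (w N) by exists 1%N; apply: left_gen_mem; rewrite inE.
  by rewrite -(WN N.+1) // => -[m]; apply: indep.
Qed.

(** * Powers and nilpotency of the radical *)

Fixpoint jacobson_pow (n : nat) : set A :=
  if n is n'.+1 then
    lspan [set x | exists y z, [/\ jacobson_pow n' y, J z & x = y * z]]
  else setT.

Lemma jacobson_powM n y z : jacobson_pow n y -> J z -> jacobson_pow n.+1 (y * z).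
Proof. by move=> ny Jz; apply/lspan_predP/mem_lspan; exists y, z. Qed.

(** A left ideal is a [k]-subspace, as [c *: x = c%:A * x], so only the generators of the span
    matter. *)
Lemma jacobson_pow_ind n X : left_ideal X ->
  (forall y z, jacobson_pow n y -> J z -> X (y * z)) -> jacobson_pow n.+1 `<=` X.
Proof.
move=> [X0 XD XM] XP x /lspan_predP xn.
pose U : {pred A} := fun x => `[< X x >].
apply/asboolP; apply: (lspan_ind (U := U)) xn => [|_ [y [z [yn Jz ->]]]].
  split=> [|c u v /asboolP Xu /asboolP Xv]; apply/asboolP => //.
  by apply: XD => //; rewrite -mulr_algl; apply: XM.
by apply/asboolP/XP.
Qed.

Lemma jacobson_pow_ideal n : two_sided_ideal (jacobson_pow n).
Proof.
elim: n => [|n [[P0 PD PM] PR]]; first by split.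
have [[J0 JD JM] JR] := jacobson_ideal A.
have [l0 lD] : jacobson_pow n.+1 0 /\
    forall x y, jacobson_pow n.+1 x -> jacobson_pow n.+1 y -> jacobson_pow n.+1 (x + y).
  split=> [|x y /lspan_predP ? /lspan_predP ?]; apply/lspan_predP.
    exact: rpred0.
  exact: rpredD.
split; first split=> // a x.
  apply: lspan_map => [|_ [y [z [yn Jz ->]]]]; first exact: mulr_linr.
  by rewrite mulrA; apply: jacobson_powM => //; apply: PM.
move=> x a; move: x; apply: (lspan_map (mulr_linl a)) => _ [y [z [yn Jz ->]]].
by rewrite -mulrA; apply: jacobson_powM => //; apply: JR.
Qed.

Lemma jacobson_pow_decr n : jacobson_pow n.+1 `<=` jacobson_pow n.
Proof.
have [lP PR] := jacobson_pow_ideal n.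
by apply: jacobson_pow_ind => // y z yn _; apply: PR.
Qed.

(* If [I = r^N = r^(N+1)] is nonzero, take [x] with [I x <> 0] generating a minimal
   such left ideal: then [{a | I a x = 0}] is a maximal left ideal, so it contains
   [r], and [I x = I r x = 0]. *)
Lemma jacobson_nilpotent : exists N, forall x, jacobson_pow N x -> x = 0.
Proof.
have [n|n|N PN] := artA (X := jacobson_pow).
- by have [] := jacobson_pow_ideal n.
- exact: jacobson_pow_decr.
exists N => y0 y0N; apply: contrapT => y00.
have [[I0 ID IM] IR] := jacobson_pow_ideal N.
pose P X := exists2 x, X x & exists2 y, jacobson_pow N y & y * x <> 0.
have [||L [lL [x Lx [y yN yx0]] Lmin]] := @left_artinian_min P setT.
- by split.
- by exists 1 => //; exists y0; rewrite ?mulr1.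
have [L0 LD LM] := lL.
pose K : set A := [set a | forall y, jacobson_pow N y -> y * a * x = 0].
have mK : maximal_left_ideal K.
  split.
  - split=> [v _|a b Ka Kb v vN|a b Kb v vN]; first by rewrite mulr0 mul0r.
      by rewrite mulrDr mulrDl Ka // Kb // addr0.
    by rewrite mulrA Kb //; apply: IR.
  - by move=> KT; apply: yx0; rewrite -[y]mulr1; have : K 1 by [rewrite KT]; apply.
  - move=> K' lK' KK'; have [K'0 K'D K'M] := lK'.
    have [K'K|] := pselect (K' `<=` K); first by left; apply/seteqP.
    move=> /existsNP[a /not_implyP[K'a /existsNP[v /not_implyP[vN vax]]]]; right.
    (* By minimality [K' x] is [L], so [x = b * x] for some [b] in [K']; then [1 - b] is in [K], and
       [1] in [K']. *)
    pose L' : set A := [set z | exists2 b, K' b & z = b * x].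
    have : L' x.
      rewrite (Lmin L') //.
      + split=> [|_ _ [b K'b ->] [c K'c ->]|c _ [b K'b ->]].
        * by exists 0; rewrite ?mul0r.
        * by exists (b + c); rewrite ?mulrDl //; apply: K'D.
        * by exists (c * b); rewrite ?mulrA //; apply: K'M.
      + by exists (a * x); [exists a | exists v; rewrite ?mulrA].
      + by move=> _ [b _ ->]; apply: LM.
    move=> [b K'b xb]; apply: left_ideal1 => //; rewrite -[1](subrK b).
    apply: K'D => //; apply: KK' => u uN.
    by rewrite -mulrA mulrBl mul1r -xb subrr mulr0.
(* Seen in [r^(N+1)], [y] is a combination of products [u * z] with [z] in [r], and [r] lies in
   [K]. *)
apply: yx0; move: yN; rewrite -(PN N.+1) //; apply: (@jacobson_pow_ind N [set y | y * x = 0]).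
  split=> [|u v ux vx|a u ux] /=; first by rewrite mul0r.
    by rewrite mulrDl ux vx addr0.
  by rewrite -mulrA ux mulr0.
by move=> u z uN Jz; apply: (Jz K).
Qed.

End LeftArtinian.

(** * Degree zero of the tensor algebra *)

Section TensorAlgebraDegree0.
Variables (k : fieldType) (R : algType k) (M : bimod R R).

Definition talg_const (a : R) : talg M := tin (a : tpow M 0).

Fact talg_const_linear : linear talg_const.
Proof. exact: (@tin_lin _ _ M 0). Qed.
Fact talg_const_monoid : monoid_morphism talg_const.
Proof.
split=> // a b; rewrite /talg_const talg_tin0.
by apply: talgP => -[|n] //=; rewrite (lin0 (tens_lact_linr _)).
Qed.
HB.instance Definition _ :=
  GRing.isLinear.Build k R (talg M) *:%R talg_const talg_const_linear.
HB.instance Definition _ :=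
  GRing.isMonoidMorphism.Build R (talg M) talg_const talg_const_monoid.

Variables (A : algType k) (rho : {lrmorphism R -> A}) (phi : {linear M -> A}).
Hypothesis phi_lact : forall a x, phi (lact a x) = rho a * phi x.
Hypothesis phi_ract : forall x a, phi (ract x a) = phi x * rho a.

(** In positive degree each lift is a sum of products that start with a value of [phi]. It serves
    with the radical and with the zero ideal as [K]. *)
Lemma talg_lift_mod (K : set A) : two_sided_ideal K -> (forall x, K (phi x)) ->
  forall f : talg M, K (talg_lift rho phi f - rho (f 0%N)).
Proof.
move=> [[K0 KD _] KR] Kphi f; have [N fN] := tcomp_supp f.
have KtS n (t : tpow M n.+1) : K (tpow_lift rho phi t).
  elim/tens_ind: t => [x t|u v Ku Kv]; last first.
    by rewrite (linD (tpow_lift_linear phi_lact phi_ract (n := n.+1))); apply: KD.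
  by rewrite (tpow_lift_tmul phi_lact phi_ract); apply: KR.
(* The bound [N.+1] guarantees a degree [0] term to split off, even for [N = 0]. *)
have fN1 n : (N.+1 <= n)%N -> f n = 0 by move=> /ltnW/fN.
rewrite (talg_liftE phi_lact phi_ract fN1) big_ord_recl addrAC subrr add0r.
apply: big_ind => // i _; exact: KtS.
Qed.

End TensorAlgebraDegree0.

(** * From a Gabriel-type presentation to a splitting *)

Section Factorization.
Variables (k : fieldType) (T A B : algType k).
Variables (p : {lrmorphism T -> A}) (f : {lrmorphism T -> B}).

(** [f] is constant on the fibres of [p], so its composite with any section of [p] is a morphism. *)
Lemma lrmorphism_factor : (forall a, exists z, p z = a) ->
  (forall z, p z = 0 -> f z = 0) ->
  exists g : {lrmorphism A -> B}, forall z, g (p z) = f z.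
Proof.
move=> p_surj kerp; have [s sK] := choice p_surj.
have fE z z' : p z = p z' -> f z = f z'.
  by move=> E; have := kerp (z - z'); rewrite !rmorphB /= E subrr => /(_ erefl)/subr0_eq.
pose g a := f (s a).
have gl : linear g.
  by move=> c a b; rewrite /g -linearP; apply: fE; rewrite linearP /= !sK.
have gm : monoid_morphism g.
  split=> [|a b]; rewrite /g -?(rmorph1 f) -?rmorphM; apply: fE.
    by rewrite sK rmorph1.
  by rewrite rmorphM /= !sK.
pose G : {lrmorphism A -> B} := HB.pack g (GRing.isLinear.Build k A B *:%R g gl)
  (GRing.isMonoidMorphism.Build A B g gm).
by exists G => z; apply: fE; rewrite sK.
Qed.

End Factorization.

(** * The radical under surjections *)

Section JacobsonRadical.
Variable k : fieldType.

(** Preimages of maximal left ideals under a surjection are maximal. *)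
Lemma jacobson_surj (A B : algType k) (f : {lrmorphism A -> B}) :
  (forall b, exists a, f a = b) ->
  forall a, jacobson_radical a -> jacobson_radical (f a).
Proof.
move=> f_surj a Ja L [[L0 LD LM] LT Lmax]; apply: (Ja [set x | L (f x)]); split.
- split=> [|x y Lx Ly|b x Lx] /=; first by rewrite rmorph0.
    by rewrite rmorphD; apply: LD.
  by rewrite rmorphM; apply: LM.
- move=> E; apply: LT; apply: left_ideal1 => //; rewrite -(rmorph1 f).
  by have : [set x | L (f x)] 1 by rewrite E.
move=> N [N0 ND NM] LN.
have lfN : left_ideal (f @` N).
  split=> [|_ _ [x Nx <-] [y Ny <-]|b _ [x Nx <-]].
  - by exists 0; rewrite ?rmorph0.
  - by exists (x + y); rewrite ?rmorphD //; apply: ND.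
  - by have [c <-] := f_surj b; exists (c * x); rewrite ?rmorphM //; apply: NM.
have [|E|E] := Lmax _ lfN.
- by move=> y Ly; have [x E] := f_surj y; exists x => //; apply: LN; rewrite /= E.
- left; apply/seteqP; split=> // x Nx; rewrite /= -E; exact: imageP.
- right; apply: left_ideal1 => //.
  have [x Nx fx] : (f @` N) 1 by rewrite E.
  rewrite -(subrK x 1); apply: ND => //; apply: LN.
  by rewrite /= rmorphB rmorph1 /= fx subrr.
Qed.

(** A maximal left ideal of [A] contains the radical, so it is saturated for [radpi] and has a
    maximal image. *)
Lemma jacobson_radquo (A : algType k) (b : radquo A) : jacobson_radical b -> b = 0.
Proof.
have [a <-] := radpi_surj b => Jb; rewrite -(rmorph0 (@radpi k A)).
apply/radpiP; rewrite subr0 => L mL; have [[L0 LD LM] LT Lmax] := mL.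
have JL x : jacobson_radical x -> L x by move=> Jx; apply: Jx.
have sat x y : radpi x = radpi y -> L y -> L x.
  by move=> /radpiP/JL Lxy Ly; rewrite -[x](subrK y); apply: LD.
suff /Jb[y Ly E] : maximal_left_ideal (@radpi k A @` L) by apply: sat (esym E) Ly.
split.
- split=> [|_ _ [x Lx <-] [y Ly <-]|c _ [x Lx <-]].
  + by exists 0; rewrite ?rmorph0.
  + by exists (x + y); rewrite ?rmorphD //; apply: LD.
  + have [d <-] := radpi_surj c.
    by exists (d * x); rewrite ?rmorphM //; apply: LM.
- move=> E; apply: LT; apply: left_ideal1 => //.
  have [x Lx Ex] : (@radpi k A @` L) 1 by rewrite E.
  by apply: sat Lx; rewrite Ex rmorph1.
move=> N [N0 ND NM] LN.
have lN : left_ideal [set x | N (radpi x)].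
  split=> [|x y Lx Ly|c x Lx] /=; first by rewrite rmorph0.
    by rewrite rmorphD; apply: ND.
  by rewrite rmorphM; apply: NM.
have [|E|E] := Lmax _ lN.
- by move=> x Lx; apply: LN; apply: imageP.
- left; apply/seteqP; split=> // y Ny; have [x xy] := radpi_surj y.
  by exists x => //; rewrite -E /= xy.
- right; apply: left_ideal1 => //; rewrite -(rmorph1 (@radpi k A)).
  by have : [set x | N (radpi x)] 1 by rewrite E.
Qed.

End JacobsonRadical.

(** * Algebras as products of their components *)

Section Components.
Variables (k : fieldType) (B : algType k) (D : ideal_decomposition B).
Local Notation P := (aprod (fun i : D => dcomp i : algType k) (didx_inhabited D)).

(** The product lies in both ideals, whose sum is direct. *)
Lemma dideal_orthogonal (i j : D) a b : i != j -> dideal i a -> dideal j b -> a * b = 0.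
Proof.
move=> ij ia jb; have [[_ _ jM] _] := dideal_ideal j; have [_ iR] := dideal_ideal i.
have iab : dideal i (a * b) by apply: iR.
have jab : dideal j (a * b) by apply: jM.
rewrite -(dproj_id jab).
rewrite (@dproj_uniq _ _ _ (fun l => if l == i then a * b else 0)).
- by rewrite eq_sym (negbTE ij).
- by move=> l; case: eqP => [->//|_]; have [[]] := dideal_ideal l.
- by rewrite -big_mkcond big_pred1_eq.
Qed.

Definition dsum (f : P) : B := \sum_i dval (f i).

Fact dsum_linear : linear dsum.
Proof. by move=> c f g; rewrite /dsum scaler_sumr -big_split. Qed.
Fact dsum_monoid : monoid_morphism dsum.
Proof.
split=> [|f g]; first by rewrite [RHS](dproj_sum D).
rewrite /dsum mulr_suml; apply: eq_bigr => i _.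
rewrite mulr_sumr (bigD1 i) //= big1 ?addr0 // => j ji.
by apply: (@dideal_orthogonal i j); rewrite 1?eq_sym //; apply: dvalP.
Qed.
HB.instance Definition _ := GRing.isLinear.Build k P B *:%R dsum dsum_linear.
HB.instance Definition _ := GRing.isMonoidMorphism.Build P B dsum dsum_monoid.

Fact dproj_in i b : dproj i b \in @dpred _ _ D i.
Proof. exact/dpredP/dproj_ideal. Qed.
Definition dsplit (b : B) : P := fun i => DComp (dproj_in i b).

Lemma dsplitK : cancel dsplit dsum.
Proof. by move=> b; rewrite [RHS](dproj_sum D). Qed.
Lemma dsumK : cancel dsum dsplit.
Proof.
move=> f; apply: functional_extensionality_dep => i; apply: val_inj => /=.
by rewrite (@dproj_uniq _ _ _ (fun j => dval (f j))) // => j; apply: dvalP.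
Qed.

Fact dsplit_linear : linear dsplit.
Proof. by move=> c a b; apply: (can_inj dsumK); rewrite linearP /= !dsplitK. Qed.
Fact dsplit_monoid : monoid_morphism dsplit.
Proof.
split=> [|a b]; apply: (can_inj dsumK); first by rewrite dsplitK rmorph1.
by rewrite rmorphM /= !dsplitK.
Qed.
HB.instance Definition _ := GRing.isLinear.Build k B P *:%R dsplit dsplit_linear.
HB.instance Definition _ := GRing.isMonoidMorphism.Build B P dsplit dsplit_monoid.

Hypothesis simpleD : forall i : D, simple_algebra (dcomp i : algType k).

(* By simplicity the kernel of [theta^n] is determined by the set of indices [i]
   with [theta^n e_i = 0]; these finite sets increase with [n]. *)
Lemma semisimple_hopfian (theta : {lrmorphism B -> B}) :
  (forall b, exists a, theta a = b) -> forall b, theta b = 0 -> b = 0.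
Proof.
move=> th_surj.
pose it n := iter n theta.
have it0 n : it n 0 = 0 by elim: n => //= n ->; rewrite rmorph0.
have itD n a b : it n (a + b) = it n a + it n b.
  by elim: n => //= n ->; rewrite rmorphD.
have itM n a b : it n (a * b) = it n a * it n b.
  by elim: n => //= n ->; rewrite rmorphM.
pose S n := [set i : D | it n (dproj i 1) == 0]%SET.
(* If the inclusion always failed, [#|S n|] would grow past [#|D|]. *)
have [n Sn] : exists n, (S n.+1 \subset S n)%SET.
  apply: contrapT => /forallNP noS.
  have card n : (n <= #|S n|)%N.
    elim: n => // n IH; apply: leq_ltn_trans IH (proper_card _).
    rewrite properE; apply/andP; split; last exact/negP/noS.
    by apply/fintype.subsetP => i; rewrite !inE /= => /eqP ->; rewrite rmorph0.
  by have := leq_trans (card #|D|.+1) (max_card _); rewrite ltnn.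
have ker c : it n.+1 c = 0 -> it n c = 0.
  move=> c0; rewrite -[c]mulr1 [1](dproj_sum D) mulr_sumr.
  apply: (big_ind (fun x => it n x = 0)) => // [x y x0 y0|i _].
    by rewrite itD x0 y0 addr0.
  have [c_i|] := eqVneq (c * dproj i 1) 0; first by rewrite c_i it0.
  rewrite -dproj_mull mulr1 => c_i.
  (* This two-sided ideal is nonzero because of [c], so it is the whole component. Hence [i] is in
     [S n.+1], and already [it n] kills the unit of the component. *)
  pose X : set (dcomp i) := [set y | it n.+1 (dval y) = 0].
  have idX : two_sided_ideal X.
    split; first split=> [|x y x0 y0|a x x0].
    - exact: it0.
    - by have := itD n.+1 (dval x) (dval y); rewrite x0 y0 addr0.
    - by have := itM n.+1 (dval a) (dval x); rewrite x0 mulr0.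
    - by move=> x a x0; have := itM n.+1 (dval x) (dval a); rewrite x0 mul0r.
  have Xc : X (DComp (dproj_in i c)).
    have : it n.+1 (dproj i c) = 0 by rewrite -[c in dproj i c]mulr1 dproj_mull itM c0 mul0r.
    by [].
  have [X0|XT] := @simpleD i X idX.
    by case/eqP: c_i; move: Xc; rewrite X0 => /(congr1 (@dval _ _ _ _)).
  have Si : i \in S n.+1.
    by rewrite inE; apply/eqP; have : X 1 by rewrite XT.
  move/fintype.subsetP/(_ i Si): Sn.
  by rewrite inE -[c]mulr1 dproj_mull itM => /eqP ->; rewrite mulr0.
(* With [b = it n a], the hypothesis reads [it n.+1 a = 0], and the kernels have stabilized at
   [n]. *)
move=> b b0; have [a ab] : exists a, it n a = b.
  elim: (n) b {b0} => [|m IH] b; first by exists b.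
  by have [c <-] := th_surj b; have [a <-] := IH c; exists a.
by rewrite -ab; apply: ker; rewrite /= -/(it n a) ab.
Qed.

End Components.

Arguments dsplit {k B} D b.

Section GabrielSplits.
Variables (k : fieldType) (A : algType k) (D : ideal_decomposition (radquo A)).
Hypothesis simpleD : forall i : D, simple_algebra (dcomp i : algType k).

Lemma gabriel_type_splits : gabriel_type D -> splits_over_radical A.
Proof.
move=> [pi [pi_surj ker_pi]].
pose M := gpa_bimod (didx_inhabited D) (fun i : D => dcomp i : algType k)
  (@natural_quiver _ _ D).
(* Lifting [dsum] with the zero map on [M] gives the projection on degree [0]. *)
pose zero : {linear M -> radquo A} := \0.
have zeroL a x : zero (lact a x) = dsum a * zero x by rewrite mulr0.
have zeroR x a : zero (ract x a) = zero x * dsum a by rewrite mul0r.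
pose aug : {lrmorphism associated_gpa D -> radquo A} := talg_lift_lrmorphism zeroL zeroR.
have augE z : aug z = dsum (z 0%N).
  apply/subr0_eq; apply: (@talg_lift_mod _ _ _ _ _ _ zeroL zeroR [set 0]) => //.
  split; first split=> [|x y -> ->|a x ->] /=; rewrite ?addr0 ?mulr0 //.
  by move=> x a -> /=; rewrite mul0r.
have [z /ker_pi/tidealE z0|theta thE] := lrmorphism_factor (f := aug) pi_surj.
  by rewrite augE z0 rmorph0.
have th_surj b : exists a, theta a = b.
  exists (pi (talg_const M (dsplit D b))).
  by rewrite thE augE [tcoef _ _]/(dsplit D b) dsplitK.
(* The surjection [theta] maps the radical of [A] into that of [A/r], which is zero. *)
have [a a0|eta etaE] := lrmorphism_factor (p := @radpi k A) (f := theta) (@radpi_surj _ _).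
  apply: jacobson_radquo; apply: (jacobson_surj th_surj).
  by rewrite -[a]subr0; apply/radpiP; rewrite a0 rmorph0.
have eta_inj := @semisimple_hopfian _ _ _ simpleD eta.
(* [radpi] after [pi], [talg_const] and [dsplit] is a right inverse of [eta]. As [eta] is injective
   it is also a left inverse, which is why [eta] is applied first. *)
pose rho : {lrmorphism radquo A -> A} := pi \o @talg_const _ _ M \o dsplit D \o eta.
exists rho => b; apply/subr0_eq/eta_inj => [c|].
  by have [a <-] := th_surj c; exists (radpi a); apply: etaE.
have E : eta (radpi (rho b)) = eta b.
  by rewrite etaE /= thE augE [tcoef _ _]/(dsplit D (eta b)) dsplitK.
by rewrite rmorphB /= E subrr.
Qed.

End GabrielSplits.

(** * From a splitting to a Gabriel-type presentation *)

Section JacobsonPowers.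
Variables (k : fieldType) (A : algType k).
Local Notation J := (@jacobson_radical k A).

Lemma jacobson_pow1 x : J x -> @jacobson_pow k A 1 x.
Proof. by move=> Jx; rewrite -[x]mul1r; apply: jacobson_powM. Qed.

Lemma jacobson_powD n m (y z : A) :
  jacobson_pow n y -> jacobson_pow m z -> jacobson_pow (n + m) (y * z).
Proof.
elim: m y z => [|m IH] y z yn zm.
  by rewrite addn0; have [_ PR] := jacobson_pow_ideal A n; apply: PR.
have [[P0 PD PM] PR] := jacobson_pow_ideal A (n + m.+1).
have [_ nR] := jacobson_pow_ideal A n.
(* Quantifying over [y] makes this set a left ideal: in [y * (a * u)] the factor [a] is absorbed by
   [y]. *)
move: z zm y yn; apply: (@jacobson_pow_ind _ _ m
  [set z | forall y, jacobson_pow n y -> jacobson_pow (n + m.+1) (y * z)]).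
  split=> [y _|u v Xu Xv y yn|a u Xu y yn] /=; first by rewrite mulr0.
    by rewrite mulrDr; apply: PD; [exact: Xu | exact: Xv].
  by rewrite mulrA; apply/Xu/nR.
move=> u z um Jz y yn; rewrite mulrA addnS.
by apply: jacobson_powM => //; apply: IH.
Qed.

(** Elements of [r^n] are approximated modulo [r^(n+1)] by multiplying approximations of their
    factors. Correcting power by power ends at [r^N = 0]. *)
Lemma surj_mod_jacobson2 (T : algType k) (p : {lrmorphism T -> A}) N :
  (forall x : A, jacobson_pow N x -> x = 0) ->
  (forall a, exists z, J (a - p z)) ->
  (forall x, J x -> exists z, jacobson_pow 2 (x - p z)) ->
  forall a, exists z, p z = a.
Proof.
move=> nilp p0 p1.
have step n a : jacobson_pow n a -> exists z, jacobson_pow n.+1 (a - p z).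
  elim: n a => [|n IH] a.
    by have [z Jz] := p0 a; exists z; apply: jacobson_pow1.
  move=> /lspan_predP an.
  have [[P0 PD PM] PR] := jacobson_pow_ideal A n.+2.
  pose U : {pred A} := fun a => `[< exists z, jacobson_pow n.+2 (a - p z) >].
  apply/asboolP; apply: (lspan_ind (U := U)) an => [|_ [y [x [yn Jx ->]]]].
    split=> [|c u v /asboolP[zu Uu] /asboolP[zv Uv]]; apply/asboolP.
      by exists 0; rewrite rmorph0 subrr.
    exists (c *: zu + zv); rewrite linearP opprD addrACA -scalerBr.
    by apply: PD => //; rewrite -mulr_algl; apply: PM.
  have [z1 y'n] := IH y yn; have [z2 x'2] := p1 x Jx; apply/asboolP.
  exists (z1 * z2); rewrite rmorphM /=.
  have -> : y * x - p z1 * p z2 = (y - p z1) * x + p z1 * (x - p z2).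
    by rewrite mulrBl mulrBr addrA subrK.
  apply: PD; first exact: jacobson_powM.
  rewrite -addn2; apply: jacobson_powD => //.
  have [lP _] := jacobson_pow_ideal A n.
  rewrite -[p z1](subKr y); apply: left_idealB => //.
  exact: jacobson_pow_decr.
have approx n a : exists z, jacobson_pow n (a - p z).
  elim: n => [|n [z zn]]; first by exists 0.
  by have [z' z'n] := step n _ zn; exists (z + z'); rewrite rmorphD opprD addrA.
by move=> a; have [z /nilp/subr0_eq az] := approx N a; exists z.
Qed.

End JacobsonPowers.

(** * Finite generation of the blocks of [r/r^2] *)

Section Blocks.
Variables (k : fieldType) (R S : algType k) (V : bimod R S).

(** A finite generating family rules out the default [0] of [block_rank], so the minimum is
    attained. *)
Lemma block_rank_generators (X : set R) (Y : set S) :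
  (exists n (g : 'I_n -> V), block_generated_by X Y g) ->
  exists g : 'I_(block_rank V X Y) -> V, block_generated_by X Y g.
Proof.
move=> [n [g gP]]; rewrite /block_rank; case: pselect => [ex|[]].
  by case: ex_minnP => m /asboolP.
by exists n; apply/asboolP; exists g.
Qed.

(** The components of [1] act as identities on their ideals, so the block is the image of an
    idempotent projection. *)
Lemma block_dideal (D : ideal_decomposition R) (D' : ideal_decomposition S)
    (j : D) (i : D') (v : V) :
  block (dideal j) (dideal i) v <-> ract (lact (dproj j 1) v) (dproj i 1) = v.
Proof.
split=> [/lspan_predP bv|<-]; last first.
  apply/lspan_predP/mem_lspan; exists (dproj j 1), v, (dproj i 1).
  by split=> //; apply: dproj_ideal.
pose U : {pred V} := fun v => ract (lact (dproj j 1) v) (dproj i 1) == v.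
apply/eqP; apply: (lspan_ind (U := U)) bv => [|_ [a [u [b [ja ib ->]]]]].
  split=> [|c x y /eqP Ux /eqP Uy].
    by rewrite /U unfold_in (lin0 (lact_linr _)) (lin0 (ract_linl _)).
  by rewrite /U unfold_in lact_linr ract_linl Ux Uy.
rewrite /U unfold_in -lractA -lactM -ractM.
by rewrite -dproj_mulr mul1r (dproj_id ja) -dproj_mull mulr1 (dproj_id ib).
Qed.

End Blocks.

Section RadicalLayer.
Variables (k : fieldType) (A : algType k) (D : ideal_decomposition (radquo A)).

Lemma rad2_jacobson_pow (u : Defs.rad A) : u \in @rad2 k A -> jacobson_pow 2 (rval u).
Proof.
move=> /lspan_predP; apply: lspan_map => // v [x [y ->]].
apply: (@jacobson_powM _ _ 1); first exact/jacobson_pow1/rad_predP/(valP x).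
exact/rad_predP/(valP y).
Qed.

Hypothesis artA : left_artinian A.

(** The preimage [X] of the block in [r] and [Y = r^2] are left ideals with [r X] inside [Y].
    Finitely many left generators of [X] over [Y] generate the block as a bimodule all the more. *)
Lemma rlayer_block_fin_gen (i j : D) : exists n (g : 'I_n -> rlayer_bimod A),
  block_generated_by (dideal j) (dideal i) g.
Proof.
set bl := @block _ _ _ (rlayer_bimod A) (dideal j) (dideal i).
have blP := block_dideal (V := rlayer_bimod A) j i; rewrite -/bl in blP.
pose X : set A := [set x | exists2 u : Defs.rad A, rval u = x & bl (rlayer_pi u)].
pose Y : set A := [set x | exists2 u : Defs.rad A, rval u = x & u \in @rad2 k A].
have pi0 (u : Defs.rad A) : u \in @rad2 k A -> rlayer_pi u = 0.
  by move=> u2; rewrite -(lin0 (@rlayer_pi_lin k A)); apply/qmod_piP; rewrite subr0.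
have [[dj0 djD djM] djR] := dideal_ideal j.
(* The whole of [A/r] acts on the block, because the unit of a component is central. *)
have bl_lact a v : bl v -> bl (lact a v).
  have central : dproj j 1 * a = a * dproj j 1.
    by rewrite -dproj_mulr -dproj_mull mul1r mulr1.
  by move=> /blP bv; apply/blP; rewrite -lactM central lactM lractA bv.
have lX : left_ideal X.
  split=> [|_ _ [u <- bu] [v <- bv]|a _ [u <- bu]].
  - by exists 0 => //; apply/lspan_predP; rewrite (lin0 (@rlayer_pi_lin k A)) rpred0.
  - exists (u + v) => //; rewrite (linD (@rlayer_pi_lin k A)).
    by apply/lspan_predP/rpredD; apply/lspan_predP.
  - by exists (rad_lmul a u) => //; rewrite -rlayer_lactE; apply: (bl_lact (radpi a)).
have lY : left_ideal Y.
  split=> [|_ _ [u <- u2] [v <- v2]|a _ [u <- u2]]; first by exists 0 => //; apply: rpred0.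
    by exists (u + v) => //; apply: rpredD.
  by exists (rad_lmul a u) => //; apply: rad2_lmul.
have YX : Y `<=` X.
  by move=> _ [u <- u2]; exists u => //; rewrite pi0 //; apply/lspan_predP/rpred0.
have JXY z x : jacobson_radical z -> X x -> Y (z * x).
  move=> /rad_predP Jz [u <- _]; exists (rad_lmul z u) => //.
  by apply: mem_lspan; exists (Rad Jz), u.
have [s sX Xs] := semisimple_layer_fin_gen artA lX lY YX JXY.
have /choice[h hP] (l : 'I_(size s)) : exists u : Defs.rad A,
    rval u = s`_l /\ bl (rlayer_pi u).
  by have [u <-] := sX _ (mem_nth 0 (ltn_ord l)); exists u.
exists (size s), (fun l => rlayer_pi (h l)).
split=> [l|]; first by have [] := hP l.
rewrite -/bl; set E := [set v | _].
apply/seteqP; split; last first.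
  move=> v; apply: (@lspan_map _ _ _ id) => // _ [l [a [b [ja ib ->]]]].
  by apply/lspan_predP/mem_lspan; exists a, (rlayer_pi (h l)), b.
elim/rlayer_ind=> u bu.
pose K : set A := [set x | exists2 u : Defs.rad A, rval u = x & lspan E (rlayer_pi u)].
suff [v /val_inj<-] : K (rval u) by [].
have : left_gen Y s (rval u) by apply: Xs; exists u.
apply.
- split=> [|_ _ [v <- Ev] [w <- Ew]|a _ [v <- Ev]].
  + by exists 0 => //; apply/lspan_predP; rewrite (lin0 (@rlayer_pi_lin k A)) rpred0.
  + exists (v + w) => //; rewrite (linD (@rlayer_pi_lin k A)).
    by apply/lspan_predP/rpredD; apply/lspan_predP.
  + exists (rad_lmul a v) => //; rewrite -rlayer_lactE.
    apply: (lspan_map (f := lact (radpi a : radquo A) : rlayer_bimod A -> _)) Ev.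
      exact: lact_linr.
    move=> _ [l [c [d [jc id ->]]]]; apply/lspan_predP/mem_lspan.
    exists l, (radpi a * c), d; split=> //; first exact: djM.
    by rewrite -lractA -lactM.
- by move=> _ [v <- v2]; exists v => //; rewrite pi0 //; apply/lspan_predP/rpred0.
- move=> w ws; have lw : (index w s < size s)%N by rewrite index_mem.
  have [hl bl_l] := hP (Ordinal lw); exists (h (Ordinal lw)).
    by rewrite hl nth_index.
  (* A generator lies in the block, so it equals its own multiple by the two units. *)
  apply/lspan_predP/mem_lspan; exists (Ordinal lw), (dproj j 1), (dproj i 1).
  by split; [exact: dproj_ideal | exact: dproj_ideal | apply/esym/blP].
Qed.

End RadicalLayer.

Lemma dsum_mul (k : fieldType) (B : algType k) (D : ideal_decomposition B)
    (a : aprod (fun i : D => dcomp i : algType k) (didx_inhabited D)) (i : D)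
    (x : dcomp i) :
  dsum a * dval x = dval (a i * x) /\ dval x * dsum a = dval (x * a i).
Proof.
split; rewrite /dsum ?mulr_suml ?mulr_sumr (bigD1 i) //= big1 ?addr0 // => j ji.
  by apply: (@dideal_orthogonal _ _ _ j i) => //; apply: dvalP.
by apply: (@dideal_orthogonal _ _ _ i j); rewrite 1?eq_sym //; apply: dvalP.
Qed.

(** * Evaluation of decorated arrows in [A] *)

Section ArrowEvaluation.
Variables (k : fieldType) (A : algType k) (D : ideal_decomposition (radquo A)).
Variable rho : {lrmorphism radquo A -> A}.
Local Notation comp := (fun i : D => dcomp i : algType k).
Local Notation P := (aprod comp (didx_inhabited D)).
Variables (i j : D) (x : A).
Local Notation N := (tens_bimod (left_regular (comp j)) (right_regular (comp i))).

(** The bimodule map out of the free bimodule on one arrow; the arrow itself goes to [x] cut down by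
    the units of both components. *)
Definition arrow_eval : N -> A :=
  tlift (fun (a : left_regular (comp j)) (b : right_regular (comp i)) =>
    rho (dval (a : dcomp j)) * x * rho (dval (b : dcomp i))).

Fact arrow_eval_balanced :
  @balanced _ _ _ _ (left_regular (comp j)) (right_regular (comp i)) A
    (fun (a : left_regular (comp j)) (b : right_regular (comp i)) =>
    rho (dval (a : dcomp j)) * x * rho (dval (b : dcomp i))).
Proof.
have dvalZ l (c : k) (u : @dcomp _ _ D l) : dval (c *: u) = c *: dval u by [].
have dvalD l (u v : @dcomp _ _ D l) : dval (u + v) = dval u + dval v by [].
split=> [b c a a'|a c b b'|a c b].
- by rewrite dvalD dvalZ linearP /= !mulrDl -!scalerAl.
- by rewrite dvalD dvalZ linearP /= mulrDr -!scalerAr.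
(* The tensor product is over [k^o], whose actions on both sides are scalings. *)
- change (rho (dval ((c : k) *: (a : dcomp j))) * x * rho (dval (b : dcomp i)) =
          rho (dval (a : dcomp j)) * x * rho (dval ((c : k) *: (b : dcomp i)))).
  by rewrite !dvalZ !linearZ /= -!scalerAl -scalerAr.
Qed.

Lemma arrow_evalE (a : dcomp j) (b : dcomp i) :
  arrow_eval (@tmul _ _ _ _ (left_regular (comp j)) (right_regular (comp i)) a b) =
  rho (dval a) * x * rho (dval b).
Proof. exact: tliftE arrow_eval_balanced _ _. Qed.

Lemma arrow_eval_linear : linear arrow_eval.
Proof. exact: tlift_linear arrow_eval_balanced. Qed.

Lemma arrow_eval_lact (f : P) (u : N) :
  arrow_eval (lact (f j) u) = rho (dsum f) * arrow_eval u.
Proof.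
elim/tens_ind: u => [a b|u v IHu IHv].
  rewrite [lact _ _]tens_lactE !arrow_evalE !mulrA -rmorphM.
  by have [-> _] := dsum_mul f (a : dcomp j).
by rewrite (linD (lact_linr _)) !(linD arrow_eval_linear) IHu IHv mulrDr.
Qed.

Lemma arrow_eval_ract (f : P) (u : N) :
  arrow_eval (ract u (f i)) = arrow_eval u * rho (dsum f).
Proof.
elim/tens_ind: u => [a b|u v IHu IHv].
  rewrite [ract _ _]tens_ractE !arrow_evalE -!mulrA -rmorphM.
  by have [_ ->] := dsum_mul f (b : dcomp i).
by rewrite (linD (ract_linl _)) !(linD arrow_eval_linear) IHu IHv mulrDl.
Qed.

Lemma arrow_eval_jacobson u : jacobson_radical x -> jacobson_radical (arrow_eval u).
Proof.
move=> Jx; have [[_ JD JM] JR] := jacobson_ideal A.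
elim/tens_ind: u => [a b|u v IHu IHv].
  by rewrite arrow_evalE; apply: JR; apply: JM.
by rewrite (linD arrow_eval_linear); apply: JD.
Qed.

End ArrowEvaluation.

(** * The presentation induced by a splitting *)

Section SplitsGabriel.
Variables (k : fieldType) (A : algType k) (D : ideal_decomposition (radquo A)).
Hypothesis artA : left_artinian A.
Variable rho : {lrmorphism radquo A -> A}.
Hypothesis rhoK : forall b, radpi (rho b) = b.
Local Notation comp := (fun i : D => dcomp i : algType k).
Local Notation t := (@natural_quiver _ _ D).
Local Notation M := (gpa_bimod (didx_inhabited D) comp t).
Local Notation W := {ij : D * D & 'I_(t ij.1 ij.2)}.

Lemma splits_gabriel_type : gabriel_type D.
Proof.
(* One generator per arrow: the arrows from [i] to [j] are as many as a minimal generating family of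
   their block has members. *)
have [g gP] : exists g : forall w : W, rlayer_bimod A, forall i j,
    block_generated_by (dideal j) (dideal i)
      (fun l : 'I_(t i j) => g (Tagged _ (l : 'I_(t (i, j).1 (i, j).2)))).
  have ex (ij : D * D) : exists g : 'I_(t ij.1 ij.2) -> rlayer_bimod A,
      block_generated_by (dideal ij.2) (dideal ij.1) g.
    exact/block_rank_generators/rlayer_block_fin_gen.
  exists (fun w => projT1 (cid (ex (tag w))) (tagged w)) => i j.
  exact: (projT2 (cid (ex (i, j)))).
pose x (w : W) : Defs.rad A := qmod_repr (g w).
have xE w : rlayer_pi (x w) = g w by apply: qmod_reprK.
pose ev (w : W) := @arrow_eval _ _ _ rho (tag w).1 (tag w).2 (rval (x w)).
pose phi_fun (m : M) : A := \sum_(w : W) ev w ((m : gpa_mod comp t) w).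
have phi_lin : linear phi_fun.
  move=> c m m'; rewrite scaler_sumr -big_split; apply: eq_bigr => w _.
  exact: arrow_eval_linear.
pose phi : {linear M -> A} :=
  HB.pack phi_fun (GRing.isLinear.Build k M A *:%R phi_fun phi_lin).
pose rho0 : {lrmorphism aprod comp (didx_inhabited D) -> A} := rho \o @dsum _ _ D.
have phi_lact a m : phi (lact a m) = rho0 a * phi m.
  rewrite /= /phi_fun mulr_sumr; apply: eq_bigr => w _; exact: arrow_eval_lact.
have phi_ract m a : phi (ract m a) = phi m * rho0 a.
  rewrite /= /phi_fun mulr_suml; apply: eq_bigr => w _; exact: arrow_eval_ract.
pose pi : {lrmorphism associated_gpa D -> A} := talg_lift_lrmorphism phi_lact phi_ract.
have [[J0 JD JM] JR] := jacobson_ideal A.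
have piE f : jacobson_radical (pi f - rho (dsum (f 0%N))).
  apply: (talg_lift_mod phi_lact phi_ract (jacobson_ideal A)) => m.
  apply: (big_ind (@jacobson_radical k A)) => // w _.
  by apply: arrow_eval_jacobson; apply/rad_predP/(valP (x w)).
exists pi; split; last first.
  move=> z z0; apply/tidealE; rewrite -[LHS](@dsumK _ _ D).
  (* Modulo [r], [pi z] is [rho] of the degree [0] part, and [radpi] undoes [rho]. *)
  have /radpiP : jacobson_radical (0 - rho (dsum (z 0%N))) by rewrite -z0.
  by rewrite rmorph0 rhoK => <-; rewrite rmorph0.
have [N nilp] := jacobson_nilpotent artA.
apply: (surj_mod_jacobson2 nilp) => [a|y Jy].
  exists (talg_const M (dsplit D (radpi a))).
  apply/radpiP; set z := talg_const _ _.
  have /radpiP -> := piE z.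
  by rewrite rhoK [tcoef _ _]/(dsplit D (radpi a)) dsplitK.
(* The classes in [r/r^2] represented in the image of [pi]. They form a subspace that contains the
   generators of every block. *)
pose lifts (v : rlayer_bimod A) := exists z (u : Defs.rad A), rval u = pi z /\ rlayer_pi u = v.
have lifts0 : lifts 0 by exists 0, 0; rewrite rmorph0 (lin0 (@rlayer_pi_lin k A)).
have liftsP c u v : lifts u -> lifts v -> lifts (c *: u + v).
  move=> [z [r [rz <-]]] [z' [r' [rz' <-]]]; exists (c *: z + z'), (c *: r + r').
  have -> : pi (c *: z + z') = c *: pi z + pi z' by apply: linearP.
  by rewrite -rz -rz' rlayer_pi_lin.
have lifts_gen w a b : dideal (tag w).2 a -> dideal (tag w).1 b ->
    lifts (ract (lact a (g w)) b).
  move=> /dpredP ja /dpredP ib.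
  (* The single arrow [w] decorated by [a] and [b]; tensored with [1] it is a path of length [1],
     with image [rho a * x w * rho b]. *)
  pose m : gpa_mod comp t := dfwith (fun w : W => 0 : arrow_bimod comp w)
    (tmul (DComp ja : left_regular (comp _)) (DComp ib : right_regular (comp _))).
  exists (@tin _ _ M 1 (tmul (m : M) (1 : regular_bimod _))).
  exists (rad_rmul (rad_lmul (rho a) (x w)) (rho b)); split.
    rewrite [RHS](talg_lift_tin phi_lact phi_ract (n := 1)).
    rewrite [RHS](tpow_lift_tmul phi_lact phi_ract (n := 0)).
    rewrite [tpow_lift _ _ _]rmorph1 mulr1.
    rewrite [RHS](bigD1 w) //= big1 ?addr0 => [|w' w'w].
      by rewrite /m dfwith_in /ev arrow_evalE.
    by rewrite /m dfwith_out 1?eq_sym // /ev (lin0 (@arrow_eval_linear _ _ _ _ _ _ _)).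
  by rewrite -rlayer_ractE -rlayer_lactE !rhoK xE.
have lifts_block (i j : D) (v : rlayer_bimod A) :
    @block _ _ _ (rlayer_bimod A) (dideal j) (dideal i) v -> lifts v.
  have [_ ->] := gP i j => /lspan_predP bv; apply/asboolP.
  pose U : {pred rlayer_bimod A} := fun v => `[< lifts v >].
  apply: (lspan_ind (U := U)) bv => [|_ [l [c [d [jc id ->]]]]]; last first.
    by apply/asboolP/lifts_gen.
  split=> [|c u w /asboolP lu /asboolP lw]; apply/asboolP => //; exact: liftsP.
(* Writing [1] as the sum of its components on both sides splits [v] into its blocks. *)
have lifts_all v : lifts v.
  have liftsD u w : lifts u -> lifts w -> lifts (u + w).
    by move=> lu lw; rewrite -[u]scale1r; apply: liftsP.
  rewrite -[v]lact1 [1](dproj_sum D) (lin_sum (lact_linl v)).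
  apply: big_ind => // j _; set u := lact _ _.
  rewrite -[u]ract1 [1](dproj_sum D) (lin_sum (ract_linr u)).
  apply: big_ind => // i _; apply: (lifts_block i j).
  apply/lspan_predP/mem_lspan; exists (dproj j 1), v, (dproj i 1).
  by split=> //; apply: dproj_ideal.
move/rad_predP: Jy => Jy.
have [z [u [uz uv]]] := lifts_all (rlayer_pi (Rad Jy)); exists z.
rewrite -uz; apply: (@rad2_jacobson_pow _ _ (Rad Jy - u)).
exact/qmod_piP/esym.
Qed.

End SplitsGabriel.

Theorem corollary3p6 (k : fieldType) (A : algType k) (artA : left_artinian A)
    (D : ideal_decomposition (radquo A))
    (simpleD : forall i : D, simple_algebra (dcomp i : algType k)) :
  splits_over_radical A <-> gabriel_type D.
Proof.
split=> [[rho rhoK]|]; first exact: splits_gabriel_type rhoK.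
exact: gabriel_type_splits.
Qed.
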